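(* Let $X$, $Y$ be Banach spaces, $1\leq p<\infty$, and let $T:X\to Y$ be a continuous linear operator. Then $\hat{T}:(\ell_{p}^{mid})^{dual}(X)\to \ell_{p^{*}}\langle Y\rangle$, $\hat T((x_j)_j)=(Tx_j)_j$, is well defined and continuous if and only if the adjoint $T^{*}\in W_{p}^{mid}(Y^{*},X^{*})$. Furthermore, $w_p^{mid}(T^{*})=\|\hat{T}\|$.
   Context: $Z$ denotes a Banach space over $\mathbb{K}$ ($=\mathbb{R}$ or $\mathbb{C}$), $Z^{*}$ its topological dual, $B_Z$ its closed unit ball. $p^{*}$ is the conjugate exponent of $p$ ($1/p+1/p^*=1$). Sequence spaces. For $1\le p<\infty$: $\ell_p^w(Z)$ is the space of sequences $(z_j)_j$ in $Z$ with $\|(z_j)_j\|_p^w=\sup_{z^*\in B_{Z^*}}(\sum_j|z^*(z_j)|^p)^{1/p}<\infty$; $\ell_p^{mid}(Z)$ is the space of sequences $(z_j)_j$ in $Z$ such that $\sum_n\sum_j|z_n^*(z_j)|^p<\infty$ for every $(z_n^* )_n\in\ell_p^w(Z^* )$, with norm $\|(z_j)_j\|_p^{mid}=\sup_{(z_n^* )_n\in B_{\ell_p^w(Z^* )}}(\sum_n\sum_j|z_n^*(z_j)|^p)^{1/p}$. $\ell_\infty^w(Z)=\ell_\infty(Z)$. $(\ell_p^{mid})^{dual}(Z)$ is the space of sequences $(z_j)_j$ in $Z$ with $\sum_j|z_j^*(z_j)|<\infty$ for all $(z_j^* )_j\in\ell_p^{mid}(Z^* )$, with norm $\|(z_j)_j\|_{p,mid}^{dual}=\sup_{(z_j^*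 )_j\in B_{\ell_p^{mid}(Z^* )}}\sum_j|z_j^*(z_j)|$. For $1\le q\le\infty$, $\ell_q\langle Z\rangle$ (Cohen strongly $q$-summable sequences) is the space of sequences $(z_j)_j$ in $Z$ with $\sum_j|z_j^*(z_j)|<\infty$ for all $(z_j^* )_j\in\ell_{q^*}^w(Z^* )$, with norm $\|(z_j)_j\|_{C,q}=\sup_{(z_j^* )_j\in B_{\ell_{q^*}^w(Z^* )}}\sum_j|z_j^*(z_j)|$. A linear operator $R:X\to Y$ is weakly mid $p$-summing, $R\in W_p^{mid}(X,Y)$, if $\ell_p^w(X)\to\ell_p^{mid}(Y)$, $(x_j)_j\mapsto(Rx_j)_j$, is well defined and continuous; $w_p^{mid}(R)$ is the norm of this map (equivalently $w_p^{mid}(R)=\sup_{S\in B_{\mathcal{L}(Y,\ell_p)}}\pi_p(SR)$ with $\pi_p$ the absolutely $p$-summing norm). *)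

(* Defs.v *)
From HB Require Import structures.
From mathcomp Require Import all_boot all_order all_algebra.
From mathcomp Require Import complex.
From mathcomp Require Import all_classical all_reals all_analysis.

Set Implicit Arguments.
Unset Strict Implicit.
Unset Printing Implicit Defensive.

Import Order.TTheory GRing.Theory Num.Theory.
Import numFieldNormedType.Exports.

Local Open Scope classical_set_scope.
Local Open Scope ring_scope.

Inductive scalar_kind := RealScalars | ComplexScalars.

Definition scalars (R : realType) (k : scalar_kind) : numFieldType :=
  match k with RealScalars => R | ComplexScalars => R[i] end.

(* In a normed module over [scalars R k] norms take their values in
   [scalars R k]; [to_real] and [of_real] convert them to and from [R]. *)
Definition to_real (R : realType) (k : scalar_kind) : scalars R k -> R :=
  match k with RealScalars => id | ComplexScalars => @complex.Re R end.

Definition of_real (R : realType) (k : scalar_kind) : R -> scalars R k :=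
  match k with
  | RealScalars => id
  | ComplexScalars => fun x : R => Complex x 0
  end.

Definition rnorm (R : realType) (k : scalar_kind)
  (V : normedModType (scalars R k)) (v : V) : R := to_real `|v|.

Section scalars_theory.
Context {R : realType} {k : scalar_kind}.
Local Notation K := (scalars R k).

Lemma of_realK : cancel (@of_real R k) (@to_real R k).
Proof. by case: k. Qed.

Lemma of_real0 : of_real k 0 = 0 :> K.
Proof. by case: k. Qed.

Lemma of_realD (x y : R) : of_real k (x + y) = of_real k x + of_real k y :> K.
Proof. by case: k => //=; apply/eqP; rewrite eq_complex /= addr0 !eqxx. Qed.

Lemma of_realM (x y : R) : of_real k (x * y) = of_real k x * of_real k y :> K.
Proof.
by case: k => //=; apply/eqP; rewrite eq_complex /= !mulr0 !mul0r subr0 addr0 !eqxx.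
Qed.

Lemma ler_of_real (x y : R) : (of_real k x <= of_real k y :> K) = (x <= y).
Proof. by case: k => //=; rewrite lecE /= eqxx. Qed.

Lemma to_realK_ge0 (x : K) : 0 <= x -> of_real k (to_real x) = x.
Proof. by case: k x => // -[a b]; rewrite lecE /= => /andP[/eqP -> _]. Qed.

Lemma of_real_norm (x : K) : of_real k (to_real `|x|) = `|x|.
Proof. exact: to_realK_ge0. Qed.

Section rnorm_theory.
Variable V : normedModType K.
Implicit Types v w : V.

Lemma of_rnorm v : of_real k (rnorm v) = `|v|.
Proof. by rewrite /rnorm to_realK_ge0. Qed.

Lemma rnorm_ge0 v : 0 <= rnorm v.
Proof. by rewrite -ler_of_real of_rnorm of_real0. Qed.

Lemma rnorm0 : rnorm (0 : V) = 0.
Proof. by rewrite /rnorm normr0 -of_real0 of_realK. Qed.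

Lemma rnorm_eq0 v : rnorm v = 0 -> v = 0.
Proof. by move=> v0; apply/normr0_eq0; rewrite -of_rnorm v0 of_real0. Qed.

Lemma ler_rnormD v w : rnorm (v + w) <= rnorm v + rnorm w.
Proof. by rewrite -ler_of_real of_realD !of_rnorm ler_normD. Qed.

Lemma rnormZ (a : K) v : rnorm (a *: v) = rnorm (a : K^o) * rnorm v.
Proof.
by apply: (can_inj of_realK); rewrite of_realM of_real_norm !of_rnorm normrZ.
Qed.

End rnorm_theory.
End scalars_theory.

Section dual.
Context {R : realType} {k : scalar_kind}.
Local Notation K := (scalars R k).
Variable Z : normedModType K.

Definition continuous_functional : {pred (Z -> K^o)} :=
  fun f => `[< linear f /\ continuous f >].

Record dual := Dual {
  dual_val :> Z -> K^o ;
  dual_valP : dual_val \in continuous_functional }.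

HB.instance Definition _ := [isSub for dual_val].
HB.instance Definition _ := [Choice of dual by <:].

Lemma continuous_functional_submod_closed :
  submod_closed continuous_functional.
Proof.
split=> [|a f g /asboolP[lf cf] /asboolP[lg cg]]; apply/asboolP; split.
- by move=> b u v; rewrite /= /GRing.zero /= scaler0 addr0.
- by move=> x; exact: cvg_cst.
- move=> b u v; rewrite !fctE lf lg !scalerDr !scalerA mulrC.
  by rewrite -!addrA; congr (_ + _); rewrite addrCA.
- by move=> x; apply: cvgD (cg x); apply: cvgZr; exact: cf.
Qed.

HB.instance Definition _ := GRing.isSubmodClosed.Build K (Z -> K^o)
  continuous_functional continuous_functional_submod_closed.
HB.instance Definition _ := [SubChoice_isSubLmodule of dual by <:].

Lemma dual_linear (f : dual) : linear f.
Proof. by have /asboolP[] := dual_valP f. Qed.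

Lemma dual_continuous (f : dual) : continuous f.
Proof. by have /asboolP[] := dual_valP f. Qed.

HB.instance Definition _ (f : dual) :=
  GRing.isLinear.Build K Z K^o *:%R f (dual_linear f).

Definition dual_norm (f : dual) : R :=
  sup [set rnorm (f x) | x in [set x : Z | rnorm x <= 1]].

Lemma dual_bounded (f : dual) :
  exists M, forall x : Z, rnorm (f x) <= M * rnorm x.
Proof.
have /linear_bounded_continuous/linear_boundedP := @dual_continuous f.
move=> /pinfty_ex_gt0[M M0 Mf]; exists (to_real M) => x.
by rewrite -(@ler_of_real R k) of_realM !of_rnorm (to_realK_ge0 (ltW M0)); exact: Mf.
Qed.

Lemma dual_has_sup (f : dual) :
  has_sup [set rnorm (f x) | x in [set x : Z | rnorm x <= 1]].
Proof.
split; first by exists (rnorm (f 0)), 0 => //=; rewrite rnorm0.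
have [M Mf] := dual_bounded f; exists `|M| => _ [x /= x1 <-].
rewrite (le_trans (Mf x))//; apply: le_trans (ler_norm _) _.
by rewrite normrM (ger0_norm (rnorm_ge0 x)) ler_piMr.
Qed.

Lemma dual_norm_ub (f : dual) (x : Z) :
  rnorm x <= 1 -> rnorm (f x) <= dual_norm f.
Proof.
by move=> x1; apply: ub_le_sup; [case: (dual_has_sup f)|exists x].
Qed.

Lemma dual_norm_ge0 (f : dual) : 0 <= dual_norm f.
Proof.
by apply: le_trans (@dual_norm_ub f 0 _); rewrite ?rnorm_ge0 ?rnorm0.
Qed.

Lemma dual_norm_le (f : dual) (c : R) :
  (forall x : Z, rnorm x <= 1 -> rnorm (f x) <= c) -> dual_norm f <= c.
Proof.
move=> fc; apply: ge_sup; first by case: (dual_has_sup f).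
by move=> _ [x /= x1 <-]; exact: fc.
Qed.

Lemma ler_dual_normD (f g : dual) :
  of_real k (dual_norm (f + g)) <=
  of_real k (dual_norm f) + of_real k (dual_norm g).
Proof.
rewrite -of_realD ler_of_real; apply: dual_norm_le => x x1.
by rewrite (le_trans (ler_rnormD _ _))// lerD// dual_norm_ub.
Qed.

Lemma dual_norm_eq0 (f : dual) : of_real k (dual_norm f) = 0 -> f = 0.
Proof.
rewrite -(@of_real0 R k) => /(can_inj (@of_realK R k)) f0.
apply: val_inj; apply/funext => x /=.
have [->|x0] := eqVneq x 0; first by rewrite linear0.
have nx0 : `|x| != 0 by rewrite normr_eq0.
suff: f (`|x|^-1 *: x) = 0.
  rewrite linearZ /= => /eqP; rewrite scaler_eq0 invr_eq0 (negbTE nx0).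
  by move=> /eqP.
apply: rnorm_eq0; apply/le_anti; rewrite rnorm_ge0 andbT -f0.
apply: dual_norm_ub; rewrite -(@ler_of_real R k) of_rnorm normrZ normfV.
rewrite normr_id mulVf//; suff -> : of_real k 1 = 1 :> K by [].
by case: (k).
Qed.

Lemma dual_normZ (a : K) (f : dual) :
  of_real k (dual_norm (a *: f)) = `|a| * of_real k (dual_norm f).
Proof.
have H (b : K) (g : dual) :
    dual_norm (b *: g) <= rnorm (b : K^o) * dual_norm g.
  apply: dual_norm_le => x x1.
  by rewrite rnormZ ler_wpM2l ?rnorm_ge0// dual_norm_ub.
rewrite -(of_rnorm (a : K^o)) -of_realM; congr of_real.
apply/le_anti; rewrite H /=.
have [->|a0] := eqVneq a 0.
  by rewrite rnorm0 mul0r dual_norm_ge0.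
have na0 : 0 < rnorm (a : K^o).
  rewrite lt_neqAle rnorm_ge0 andbT eq_sym.
  by apply: contra a0 => /eqP/rnorm_eq0/eqP.
rewrite -ler_pdivlMl// -[in leLHS](scalerK a0 f).
apply: le_trans (H _ _) _; rewrite ler_wpM2r ?dual_norm_ge0//.
rewrite -(ler_pM2l na0) mulfV ?gt_eqF// -rnormZ.
by rewrite /GRing.scale /= mulfV// -(@ler_of_real R k) of_rnorm normr1; case: (k).
Qed.

HB.instance Definition _ := Lmodule_isNormed.Build K dual
  ler_dual_normD dual_normZ dual_norm_eq0.

Lemma dual_normE (f : dual) : rnorm f = dual_norm f.
Proof. by rewrite /rnorm (@of_realK R k). Qed.

End dual.

Section adjoint.
Context {R : realType} {k : scalar_kind}.
Local Notation K := (scalars R k).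
Variables (X Y : normedModType K) (T : {linear X -> Y}).
Hypothesis cT : continuous T.

Lemma adjoint_subproof (g : dual Y) :
  (g \o T : X -> K^o) \in @continuous_functional R k X.
Proof.
apply/asboolP; split; first by move=> a u v; rewrite /= !linearP.
by move=> x; apply: continuous_comp; [exact: cT|exact: dual_continuous].
Qed.

Definition adjoint (g : dual Y) : dual X := Dual (adjoint_subproof g).

Lemma adjoint_linear : linear adjoint.
Proof. by move=> a f g; exact: val_inj. Qed.

HB.instance Definition _ :=
  GRing.isLinear.Build K (dual Y) (dual X) *:%R adjoint adjoint_linear.

End adjoint.

(* The norm is extended-valued and total; it is only meaningful on members. *)
Record seq_space (R : realType) (V : Type) := SeqSpace {
  seq_mem : set (nat -> V) ;
  seq_norm : (nat -> V) -> \bar R }.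

Definition seq_ball (R : realType) (V : Type) (E : seq_space R V) :
  set (nat -> V) := [set z | seq_mem E z /\ (seq_norm E z <= 1)%E].

Section sequence_spaces.
Context {R : realType} {k : scalar_kind}.
Local Notation K := (scalars R k).
Local Open Scope ereal_scope.

(* ell_r^w(Z) for 1 <= r <= +oo; the case -oo is a dummy. *)
Definition weak_norm (r : \bar R) (Z : normedModType K) (z : nat -> Z) :
    \bar R :=
  match r with
  | p%:E => ereal_sup
      [set (\sum_(j <oo) (rnorm (f (z j)) `^ p)%:E) `^ p^-1
      | f in [set f : dual Z | (rnorm f <= 1)%R]]
  | +oo => ereal_sup (range (fun j => (rnorm (z j))%:E))
  | -oo => +oo
  end.

Definition ell_weak (r : \bar R) (Z : normedModType K) : seq_space R Z :=
  SeqSpace [set z | weak_norm r z < +oo] (@weak_norm r Z).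

Definition mid_sum (p : R) (Z : normedModType K) (f : nat -> dual Z)
    (z : nat -> Z) : \bar R :=
  \sum_(n <oo) \sum_(j <oo) (rnorm (f n (z j)) `^ p)%:E.

Definition ell_mid (p : R) (Z : normedModType K) : seq_space R Z :=
  SeqSpace
    [set z | forall f : nat -> dual Z,
       seq_mem (ell_weak p%:E (dual Z)) f -> mid_sum p f z < +oo]
    (fun z => ereal_sup [set mid_sum p f z `^ p^-1
                        | f in seq_ball (ell_weak p%:E (dual Z))]).

Definition pairing_sum (Z : normedModType K) (f : nat -> dual Z)
    (z : nat -> Z) : \bar R :=
  \sum_(j <oo) (rnorm (f j (z j)))%:E.

Definition pairing_dual (Z : normedModType K) (E : seq_space R (dual Z)) :
    seq_space R Z :=
  SeqSpace
    [set z | forall f : nat -> dual Z, seq_mem E f -> pairing_sum f z < +oo]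
    (fun z => ereal_sup [set pairing_sum f z | f in seq_ball E]).

Definition ell_mid_dual (p : R) (Z : normedModType K) : seq_space R Z :=
  pairing_dual (ell_mid p (dual Z)).

Definition ell_cohen (q : \bar R) (Z : normedModType K) : seq_space R Z :=
  pairing_dual (ell_weak (hoelder_conjugate q) (dual Z)).

End sequence_spaces.

Section induced_maps.
Context {R : realType} {k : scalar_kind}.
Local Notation K := (scalars R k).
Variables (X Y : normedModType K) (E : seq_space R X) (F : seq_space R Y).
Implicit Type u : {linear X -> Y}.

Definition seq_map u (x : nat -> X) : nat -> Y := fun j => u (x j).

Definition induced_well_defined u :=
  forall x, seq_mem E x -> seq_mem F (seq_map u x).

Definition induced_continuous u :=
  forall x, seq_mem E x -> forall e : R, 0 < e -> exists2 d : R, 0 < d &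
    forall x', seq_mem E x' -> (seq_norm E (x' - x)%R < d%:E)%E ->
      (seq_norm F (seq_map u x' - seq_map u x)%R < e%:E)%E.

Definition induced_norm u : \bar R :=
  ereal_sup [set seq_norm F (seq_map u x) | x in seq_ball E].

End induced_maps.

Section weakly_mid_summing.
Context {R : realType} {k : scalar_kind}.
Local Notation K := (scalars R k).
Variables (p : R) (X Y : normedModType K) (u : {linear X -> Y}).

Definition weakly_mid_summing :=
  induced_well_defined (ell_weak p%:E X) (ell_mid p Y) u /\
  induced_continuous (ell_weak p%:E X) (ell_mid p Y) u.

Definition weakly_mid_norm : \bar R :=
  induced_norm (ell_weak p%:E X) (ell_mid p Y) u.

End weakly_mid_summing.

(* Main.v *)
(* Since sum |f_j(T x_j)| = sum |(T* f_j)(x_j)|, a bound for T* gives the same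
   bound for T^ at once.  The converse needs the mid norm on X* to be recovered
   from the pairing with sequences of X: for h in X* and phi in the weak p-ball
   of X**, l_p duality writes (sum_{n,j} |phi_n(h_j)|^p)^(1/p) as
   sum_n phi_n(g_n) with g_n = sum_j b_nj h_j, a Helly-type lemma replaces phi
   by vectors x_n in the weak p-ball of X, and y_j = sum_n b_nj x_n lies in the
   unit ball of (l_p^mid)^dual(X).  Helly's lemma comes from a finite norming
   set of l_p^n together with the Hahn-Banach theorem, and the latter from the
   fact that a minimal sublinear functional is linear. *)
Require Import Defs.
From HB Require Import structures.
From mathcomp Require Import all_boot all_order all_algebra.
From mathcomp Require Import complex lra ring.
From mathcomp Require Import all_classical all_reals all_analysis.

Set Implicit Arguments.
Unset Strict Implicit.
Unset Printing Implicit Defensive.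

Import Order.TTheory GRing.Theory Num.Theory.
Import numFieldNormedType.Exports.

Local Open Scope classical_set_scope.
Local Open Scope ring_scope.

(** * The Hahn-Banach theorem *)

(** The obstacle is that the mid norm on [dual X] is tested by sequences of [dual (dual X)], while a
    bound for [T] only concerns sequences of [X]. Every norm involved is a supremum of finite
    partial sums, so only finitely many [phi n] and [h j] matter at a time, and Helly's lemma is
    proved for such finite families. The dual of [X^J] under the weak [p]-norm has no convenient
    description; testing with a finite norming set instead turns that norm into a max norm on a
    finite power of [X], at the price of a factor [1 + e] that disappears in the limit. The equality
    of the norms costs no extra estimate: bounds pass between [T] and its adjoint with the same
    constant [C], and two values of [[0, +oo]] with the same finite upper bounds agree. *)

Section hahn_banach.
Context {R : realType} {k : scalar_kind}.
Local Notation K := (scalars R k).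
Variable V : lmodType K.
Implicit Types (q : V -> R) (x y v w : V) (t : R).

Lemma of_real1 : of_real k 1 = 1 :> K.
Proof. by case: k. Qed.

Lemma of_realN t : of_real k (- t) = - of_real k t :> K.
Proof. by apply/eqP; rewrite -subr_eq0 opprK -of_realD addNr of_real0. Qed.

(** Real scaling makes every [K]-space a real vector space, so that one real Hahn-Banach argument
    serves both scalar fields. *)
Definition rscale t v : V := of_real k t *: v.

Lemma rscaleA t s v : rscale t (rscale s v) = rscale (t * s) v.
Proof. by rewrite /rscale scalerA -of_realM. Qed.

Lemma rscale1 v : rscale 1 v = v.
Proof. by rewrite /rscale of_real1 scale1r. Qed.

Definition sublinear q :=
  (forall v w, q (v + w) <= q v + q w) /\
  (forall t v, 0 < t -> q (rscale t v) <= t * q v).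

Lemma sublinearZ q t v : sublinear q -> 0 < t -> q (rscale t v) = t * q v.
Proof.
move=> [_ qZ] t0; apply/le_anti; rewrite qZ//= -ler_pdivlMl//.
by rewrite (le_trans _ (qZ _ _ _)) ?invr_gt0// rscaleA mulVf ?gt_eqF// rscale1.
Qed.

Lemma sublinear0 q : sublinear q -> q 0 = 0.
Proof.
move=> sq; have := sublinearZ 0 sq (ltr0n R 2).
by rewrite /rscale scaler0 => ?; lra.
Qed.

Lemma sublinearN_ge q v : sublinear q -> - q (- v) <= q v.
Proof.
move=> sq; rewrite -subr_ge0 opprK -(sublinear0 sq) -(subrr v).
by case: sq => + _; apply.
Qed.

Record cone (S : set (V * R)) : Prop := Cone {
  cone0 : S (0, 0) ;
  coneD : forall c d, S c -> S d -> S (c.1 + d.1, c.2 + d.2) ;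
  coneZ : forall t c, 0 < t -> S c -> S (rscale t c.1, t * c.2) }.

(** A pair [(v, r)] of [S] encodes the constraint [F v <= r]. Under the hypotheses of the next
    section this is the largest sublinear functional below [q] that meets all these constraints. *)
Definition inf_conv (S : set (V * R)) q v : R :=
  inf [set q (v - c.1) + c.2 | c in S].

Section inf_conv.
Variables (S : set (V * R)) (q : V -> R).
Hypotheses (cS : cone S) (sq : sublinear q).
Hypothesis qS : forall c, S c -> 0 <= q (- c.1) + c.2.

Lemma inf_conv_lb v c : S c -> inf_conv S q v <= q (v - c.1) + c.2.
Proof.
move=> Sc; apply: ge_inf; last by exists c.
exists (- q (- v)) => _ [d Sd <-]; rewrite -subr_ge0 opprK.
apply: le_trans (qS Sd) _; rewrite addrAC lerD2r.
by rewrite (le_trans _ (sq.1 _ _))// addrAC subrr add0r.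
Qed.

Lemma le_inf_conv v t :
  (forall c, S c -> t <= q (v - c.1) + c.2) -> t <= inf_conv S q v.
Proof.
move=> H; apply: lb_le_inf; last by move=> _ [c Sc <-]; exact: H.
by exists (q (v - 0) + 0), (0, 0) => //; exact: cone0.
Qed.

Lemma inf_conv_le v : inf_conv S q v <= q v.
Proof.
by rewrite (le_trans (inf_conv_lb v (cone0 cS)))//= subr0 addr0.
Qed.

Lemma inf_conv_cone c : S c -> inf_conv S q c.1 <= c.2.
Proof.
move=> Sc; rewrite (le_trans (inf_conv_lb _ Sc))// subrr sublinear0//.
by rewrite add0r.
Qed.

Lemma sublinear_inf_conv : sublinear (inf_conv S q).
Proof.
split=> [v w|t v t0].
  rewrite -lerBlDl; apply: le_inf_conv => d Sd.
  rewrite lerBlDr -lerBlDl; apply: le_inf_conv => c Sc.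
  rewrite lerBlDl [leRHS]addrC (le_trans (inf_conv_lb _ (coneD cS Sc Sd)))//=.
  rewrite addrACA lerD2r (le_trans _ (sq.1 _ _))//.
  by rewrite opprD addrACA.
rewrite -ler_pdivrMl//; apply: le_inf_conv => c Sc.
rewrite ler_pdivrMl// (le_trans (inf_conv_lb _ (coneZ cS t0 Sc)))//=.
by rewrite /rscale -scalerBr -/(rscale _ _) sublinearZ// mulrDr.
Qed.

End inf_conv.

Lemma minimal_sublinear q : sublinear q -> exists F,
  [/\ sublinear F, forall v, F v <= q v &
      forall F', sublinear F' -> (forall v, F' v <= F v) -> F' = F].
Proof.
move=> sq; pose P F := sublinear F /\ forall v, F v <= q v.
have Pq : P q by [].
(* The order is reversed: maximal elements for Zorn's lemma are minimal functionals. *)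
pose le_rel (F G : {F | P F}) := `[< forall v, sval G v <= sval F v >].
have [|||[F [sF Fq]] Fmin] := @ZL_preorder _ (exist _ q Pq) le_rel.
- by move=> F; apply/asboolP.
- move=> F G H /asboolP FG /asboolP GH; apply/asboolP => v.
  exact: le_trans (FG v).
- move=> A totA; have [[F0 AF0]|A0] := pselect (exists F, A F); last first.
    by exists (exist _ q Pq) => F AF; exfalso; apply: A0; exists F.
  pose G v := inf [set sval F v | F in A].
  have Glb F v : A F -> G v <= sval F v.
    move=> AF; apply: ge_inf; last by exists F.
    exists (- q (- v)) => _ [[H [sH Hq]] AH <-] /=.
    by rewrite (le_trans _ (sublinearN_ge v sH))// lerN2.
  have leG v t : (forall F, A F -> t <= sval F v) -> t <= G v.
    move=> H; apply: lb_le_inf; last by move=> _ [F AF <-]; exact: H.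
    by exists (sval F0 v), F0.
  have PG : P G.
    split; last by move=> v; rewrite (le_trans (Glb _ _ AF0))//; case: (svalP F0).
    split=> [v w|t v t0].
      rewrite -lerBlDl; apply: (leG _ _ _) => F AF.
      rewrite lerBlDr -lerBlDl; apply: (leG _ _ _) => H AH; rewrite lerBlDl.
      (* The pointwise infimum of a chain stays subadditive because the smaller of [F] and [H] can
         be used at both [v] and [w]. *)
      have [/asboolP FH|/asboolP HF] := totA _ _ AF AH.
        rewrite (le_trans (Glb _ _ AH))//.
        by rewrite (le_trans ((svalP H).1.1 _ _))// addrC lerD2r.
      rewrite (le_trans (Glb _ _ AF))//.
      by rewrite (le_trans ((svalP F).1.1 _ _))// addrC lerD2l.
    rewrite -ler_pdivrMl//; apply: (leG _ _ _) => F AF; rewrite ler_pdivrMl//.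
    by rewrite (le_trans (Glb _ _ AF))//; case: (svalP F) => -[_ +] _; apply.
  by exists (exist _ G PG) => F AF; apply/asboolP => v; exact: Glb.
exists F; split=> // F' sF' F'F; apply/funext => v; apply/le_anti.
have PF' : P F' by split=> // w; exact: le_trans (Fq w).
have := Fmin (exist _ F' PF'); rewrite /le_rel /= => /(_ _)/asboolP -> //.
by rewrite andbT.
by apply/asboolP.
Qed.

Definition rlinear (F : V -> R) :=
  (forall v w, F (v + w) = F v + F w) /\ (forall t v, F (rscale t v) = t * F v).

(* For each [y], the inf-convolution of a minimal sublinear [F] with the cone
   generated by [(- y, - F y)] is again [F]; this is superadditivity. *)
Lemma minimal_sublinear_rlinear F : sublinear F ->
  (forall F', sublinear F' -> (forall v, F' v <= F v) -> F' = F) -> rlinear F.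
Proof.
move=> sF Fmin.
have FD v w : F (v + w) = F v + F w.
  apply/le_anti; rewrite sF.1 /=.
  pose S := [set (rscale t (- w), - (t * F w)) | t in [set t | 0 <= t]].
  have cS : cone S.
    split; first by exists 0; rewrite //= /rscale of_real0 scale0r mul0r oppr0.
    - move=> _ _ [t t0 <-] [s s0 <-] /=; exists (t + s); first exact: addr_ge0.
      by rewrite /rscale of_realD scalerDl mulrDl opprD.
    - move=> t _ t0 [s s0 <-] /=; exists (t * s); first exact: mulr_ge0 (ltW t0) s0.
      by rewrite rscaleA mulrN mulrA.
  have FS c : S c -> 0 <= F (- c.1) + c.2.
    move=> [t /= + <-] /=; rewrite le_eqVlt => /predU1P[<-|t0].
      by rewrite /rscale of_real0 scale0r mul0r !oppr0 sublinear0 ?addr0.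
    by rewrite /rscale scalerN opprK -/(rscale _ _) sublinearZ// subrr.
  have := Fmin _ (sublinear_inf_conv cS sF FS) (inf_conv_le cS sF FS).
  have S1 : S (- w, - F w) by exists 1; rewrite /= ?ler01// rscale1 mul1r.
  move=> /(congr1 (fun f => f v)) <-.
  by rewrite -lerBrDr (le_trans (inf_conv_lb sF FS v S1))//= opprK.
have FN v : F (- v) = - F v.
  by apply/eqP; rewrite -addr_eq0 -FD addNr sublinear0.
split=> // t v; have [->|tN0] := eqVneq t 0.
  by rewrite /rscale of_real0 scale0r mul0r sublinear0.
have [t0|t0] := ltP 0 t; first exact: sublinearZ.
rewrite -[t]opprK /rscale of_realN scaleNr FN -/(rscale _ _) sublinearZ//.
  by rewrite !mulNr.
by rewrite oppr_gt0 lt_neqAle tN0.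
Qed.

(** The inf-convolution already obeys both families of upper bounds, hence so does any minimal
    sublinear functional below it, and minimality makes that one linear. *)
Theorem mazur_orlicz (S : set (V * R)) q : cone S -> sublinear q ->
  (forall c, S c -> 0 <= q (- c.1) + c.2) ->
  exists F, [/\ rlinear F, forall v, F v <= q v & forall c, S c -> F c.1 <= c.2].
Proof.
move=> cS sq qS.
have [F [sF Fq Fmin]] := minimal_sublinear (sublinear_inf_conv cS sq qS).
exists F; split; first exact: minimal_sublinear_rlinear.
  by move=> v; rewrite (le_trans (Fq v))// inf_conv_le.
by move=> c Sc; rewrite (le_trans (Fq _))// inf_conv_cone.
Qed.

End hahn_banach.

(** * Scalars and linear functionals over both fields *)

Section scalars.
Context {R : realType} {k : scalar_kind}.
Local Notation K := (scalars R k).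
Implicit Types (z a : K) (t : R).

Lemma to_realD z a : to_real (z + a) = to_real z + to_real a.
Proof. by case: k z a => // -[? ?] [? ?]. Qed.

Lemma to_real0 : to_real (0 : K) = 0.
Proof. by case: k. Qed.

Lemma to_realN z : to_real (- z) = - to_real z.
Proof. by apply/eqP; rewrite -addr_eq0 -to_realD addNr to_real0. Qed.

Lemma to_real_sum (I : Type) (r : seq I) (P : pred I) (F : I -> K) :
  to_real (\sum_(i <- r | P i) F i) = \sum_(i <- r | P i) to_real (F i).
Proof. exact: (big_morph _ to_realD to_real0). Qed.

Lemma to_real_ofM t z : to_real (of_real k t * z) = t * to_real z.
Proof. by case: k z => // -[? ?] /=; rewrite mul0r subr0. Qed.

Lemma ler_to_real z : to_real z <= rnorm (z : K^o).
Proof.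
rewrite /rnorm; case: k z => [z|[x y]]; first exact: ler_norm.
by rewrite /= (le_trans (ler_norm _))// -sqrtr_sqr ler_wsqrtr// lerDl sqr_ge0.
Qed.

Lemma rnorm_of t : rnorm (of_real k t : K^o) = `|t|.
Proof.
rewrite /rnorm; case: k => //=.
by rewrite expr0n/= addr0 sqrtr_sqr.
Qed.

Lemma rnormM z a : rnorm (z * a : K^o) = rnorm (z : K^o) * rnorm (a : K^o).
Proof. exact: rnormZ. Qed.

Lemma rnorm_phase z :
  exists a, rnorm (a : K^o) <= 1 /\ a * z = of_real k (rnorm (z : K^o)).
Proof.
have [->|z0] := eqVneq z 0.
  by exists 0; rewrite rnorm0 mul0r of_real0 ler01.
exists (`|z| / z); split; last by rewrite mulfVK// of_rnorm.
rewrite -(@ler_of_real R k) of_rnorm normrM normfV normr_id.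
by rewrite mulfV ?normr_eq0// of_real1.
Qed.

Lemma to_real_eq0 z : (forall a, to_real (a * z) = 0) -> z = 0.
Proof.
have [a [_ az]] := rnorm_phase z; move=> /(_ a).
by rewrite az of_realK; exact: (@rnorm_eq0 _ _ K^o).
Qed.

Lemma rnorm_sum (V : normedModType K) (I : Type) (r : seq I) (P : pred I)
    (F : I -> V) :
  rnorm (\sum_(i <- r | P i) F i) <= \sum_(i <- r | P i) rnorm (F i).
Proof.
elim/big_ind2 : _ => //; first by rewrite rnorm0.
move=> u x v y ux vy; rewrite (le_trans (ler_rnormD _ _))//.
exact: lerD.
Qed.

Lemma rnormN (V : normedModType K) (v : V) : rnorm (- v) = rnorm v.
Proof. by rewrite /rnorm normrN. Qed.

Lemma rnorm_rscale (V : normedModType K) t (v : V) :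
  rnorm (rscale t v) = `|t| * rnorm v.
Proof. by rewrite /rscale rnormZ rnorm_of. Qed.

(** In the complex case [F] is the real part of the complex-linear functional [F v - i F (i v)]. *)
Lemma rlinear_to_real (V : lmodType K) (F : V -> R) : rlinear F ->
  exists G : {linear V -> K^o}, forall v, to_real (G v) = F v.
Proof.
move=> lF; suff [G lG GF] : exists2 G : V -> K^o, linear G &
    forall v, to_real (G v) = F v.
  exists (HB.pack_for {linear V -> K^o} G
    (GRing.isLinear.Build K V K^o *:%R G lG)); exact: GF.
move: lF; rewrite /rlinear /rscale; case: k V F => [V F [FD FZ]|V F [FD FZ]].
  by exists F => // a u v; rewrite FD FZ.
exists (fun v => Complex (F v) (- F ('i%C *: v))) => // -[a b] u v.
have cE w : Complex a b *: w = Complex a 0 *: w + Complex b 0 *: ('i%C *: w).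
  rewrite scalerA -scalerDl; congr (_ *: _); apply/eqP.
  by rewrite eq_complex /= !mulr0 !mul0r !mulr1 subr0 !addr0 !add0r !eqxx.
have iiE w : 'i%C *: ('i%C *: w) = Complex (-1) 0 *: w.
  rewrite scalerA; congr (_ *: _); apply/eqP.
  by rewrite eq_complex /= !mulr0 !mul0r mulr1 sub0r addr0 !eqxx.
have icE w : 'i%C *: (Complex a b *: w) =
    Complex a 0 *: ('i%C *: w) + Complex b 0 *: (Complex (-1) 0 *: w).
  by rewrite -iiE -cE !scalerA mulrC.
rewrite scalerDr icE cE !FD !FZ.
by apply/eqP; rewrite eq_complex /=; apply/andP; split; apply/eqP; ring.
Qed.

Lemma continuous_functionalP (Z : normedModType K) (f : Z -> K^o) (M : R) :
  linear f -> (forall x, rnorm (f x) <= M * rnorm x) ->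
  f \in @continuous_functional R k Z.
Proof.
move=> lf fM; apply/asboolP; split=> //.
pose F : {linear Z -> K^o} :=
  HB.pack_for {linear Z -> K^o} f (GRing.isLinear.Build K Z K^o *:%R f lf).
apply: (@bounded_linear_continuous _ _ _ F); apply/linear_boundedP.
near=> r => x; rewrite -!of_rnorm.
rewrite (@le_trans _ _ (of_real k M * of_real k (rnorm x)))//.
  by rewrite -of_realM ler_of_real.
rewrite ler_wpM2r//; first by rewrite of_rnorm.
near: r; apply: nbhs_pinfty_ge.
by rewrite realE -!(@of_real0 R k) !ler_of_real; exact: le_total.
Unshelve. all: by end_near. Qed.

Lemma dual_sumE (Z : normedModType K) (I : Type) (r : seq I) (P : pred I)
    (f : I -> dual Z) (z : Z) :
  (\sum_(i <- r | P i) f i) z = \sum_(i <- r | P i) (f i z : K).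
Proof. by elim/big_rec2 : _ => // i y1 y2 _ <-. Qed.

End scalars.

(** * Decomposition of functionals on a finite power of [X] *)

Section decomposition.
Context {R : realType} {k : scalar_kind}.
Local Notation K := (scalars R k).
Variables (X : normedModType K) (I J : finType).

Let maxnorm (z : I -> X) : R := \big[Num.max/0]_i rnorm (z i).

Let maxnorm_ub z i : rnorm (z i) <= maxnorm z.
Proof. exact: (le_bigmax _ (fun i => rnorm (z i))). Qed.

Let maxnorm_ge0 z : 0 <= maxnorm z.
Proof. exact: bigmax_ge_id. Qed.

Let maxnorm_le z t : 0 <= t -> (forall i, rnorm (z i) <= t) -> maxnorm z <= t.
Proof. by move=> t0 H; apply: bigmax_le => // i _; exact: H. Qed.

Let sublinear_maxnorm (C : R) : 0 <= C -> sublinear (fun z : I -> X => C * maxnorm z).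
Proof.
move=> C0; split=> [v w|t v t0].
  rewrite -mulrDr ler_wpM2l//; apply: maxnorm_le => [|i]; first by rewrite addr_ge0.
  by rewrite (le_trans (ler_rnormD _ _))// lerD.
rewrite mulrCA ler_wpM2l//; apply: maxnorm_le => [|i].
  by rewrite mulr_ge0// ltW.
by rewrite [X in rnorm X]/(rscale t (v i)) rnorm_rscale gtr0_norm// ler_wpM2l// ltW.
Qed.

Variables (a : I -> J -> K) (g : J -> dual X).

Let comb (x : J -> X) : I -> X := fun i => \sum_n a i n *: x n.
Let pairing (x : J -> X) : K := \sum_n (g n (x n) : K).

Let combZ t x i : comb (fun n => rscale t (x n)) i = rscale t (comb x i).
Proof.
by rewrite /comb /rscale scaler_sumr; apply: eq_bigr => n _; rewrite !scalerA mulrC.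
Qed.

Let pairZ t x : to_real (pairing (fun n => rscale t (x n))) = t * to_real (pairing x).
Proof.
rewrite -to_real_ofM /pairing mulr_sumr; congr to_real.
by apply: eq_bigr => n _; rewrite /rscale linearZ.
Qed.

Let combD x y : comb (fun n => x n + y n) = comb x + comb y.
Proof.
apply/funext => i; rewrite /comb !fctE -big_split.
by apply: eq_bigr => n _; rewrite scalerDr.
Qed.

Let pairD x y : pairing (fun n => x n + y n) = pairing x + pairing y.
Proof. by rewrite /pairing -big_split; apply: eq_bigr => n _; rewrite linearD. Qed.

(* The functional [x |-> sum_n g n (x n)] on [X^J] factors through the map
   [x |-> (sum_n a i n *: x n)_i] into [X^I] with the max norm, whose dual is
   [(X^* )^I] with the sum norm. *)
Lemma dual_decomposition (C : R) : 0 <= C ->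
  (forall x : J -> X, (forall i, rnorm (\sum_n a i n *: x n) <= 1) ->
    to_real (\sum_n (g n (x n) : K)) <= C) ->
  exists2 f : I -> dual X, (forall n, g n = \sum_i a i n *: f i) &
    \sum_i rnorm (f i) <= C.
Proof.
move=> C0 H.
have pair_le x : to_real (pairing x) <= C * maxnorm (comb x).
  apply/ler_addgt0Pr => e e0; have C1 : 0 < C + 1 by rewrite ltr_wpDl.
  (* The added term keeps [m] positive when all combinations vanish, and contributes at most
     [C * e / (C + 1) <= e]. *)
  pose m := maxnorm (comb x) + e / (C + 1).
  have m0 : 0 < m by rewrite ltr_wpDl// divr_gt0.
  have := H (fun n => rscale m^-1 (x n)).
  rewrite -/(pairing _) pairZ ler_pdivrMl// => /(_ _)/le_trans; apply.
    move=> i; rewrite -/(comb _ i) combZ rnorm_rscale gtr0_norm ?invr_gt0//.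
    by rewrite ler_pdivrMl// mulr1 (le_trans (maxnorm_ub _ _))// lerDl divr_ge0// ltW.
  rewrite mulrC mulrDr lerD2l mulrA ler_pdivrMr// mulrC ler_wpM2l ?ltW//.
  by rewrite ltrDl.
(* [S] contains the opposite of each of its pairs, so the inequalities [F c.1 <= c.2] amount to
   [F (comb x) = to_real (pairing x)]. *)
pose S : set ((I -> X) * R) := range (fun x => (comb x, to_real (pairing x))).
have cS : cone S.
  split.
  - exists (fun=> 0) => //; congr (_, _).
      by apply/funext => i; rewrite /comb big1// => n _; rewrite scaler0.
    by rewrite /pairing big1 ?to_real0// => n _; rewrite linear0.
  - move=> _ _ [x _ <-] [y _ <-] /=; exists (fun n => x n + y n) => //.
    by rewrite combD pairD to_realD.
  - move=> t _ t0 [x _ <-] /=; exists (fun n => rscale t (x n)) => //.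
    by rewrite pairZ; congr (_, _); apply/funext => i; rewrite combZ.
have [|F [lF FC FS]] := mazur_orlicz cS (sublinear_maxnorm C0).
  move=> _ [x _ <-] /=; have := pair_le (fun n => rscale (-1) (x n)).
  rewrite pairZ mulN1r lerNl -subr_ge0 opprK addrC.
  suff -> : comb (fun n => rscale (-1) (x n)) = - comb x by [].
  apply/funext => i; rewrite combZ /rscale of_realN of_real1.
  by rewrite scaleN1r.
have [G GF] := rlinear_to_real lF.
pose inj i (x : X) : I -> X := fun j => if j == i then x else 0.
(* The bound on [F] controls only the real part of [G]; rotating [z] by a phase turns it into a
   bound on the modulus. *)
have GC z : rnorm (G z) <= C * maxnorm z.
  have [b [b1 bz]] := rnorm_phase (G z).
  rewrite -(@of_realK R k (rnorm _)) -bz.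
  have -> : b * G z = G (b *: z) by rewrite linearZ.
  rewrite GF (le_trans (FC _))// ler_wpM2l//; apply: maxnorm_le => // i.
  by rewrite [X in rnorm X]/(b *: z i) rnormZ -[leRHS]mul1r ler_pM ?rnorm_ge0.
have inj_lin i : linear (fun x => G (inj i x)).
  move=> b u v; rewrite -linearP; congr (G _); apply/funext => j.
  by rewrite /inj !fctE; case: ifP => // _; rewrite scaler0 addr0.
have inj_bnd i x : rnorm (G (inj i x)) <= C * rnorm x.
  rewrite (le_trans (GC _))// ler_wpM2l//; apply: maxnorm_le => [|j].
    exact: rnorm_ge0.
  by rewrite /inj; case: ifP => // _; rewrite rnorm0 rnorm_ge0.
have [f Gf] : exists f : I -> dual X,
    forall z : I -> X, G z = \sum_i (f i (z i) : K).
  exists (fun i => Dual (continuous_functionalP (inj_lin i) (inj_bnd i))) => z.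
  rewrite -linear_sum; congr (G _); apply/funext => j.
  rewrite fct_sumE (bigD1 j)//= /inj eqxx big1 ?addr0// => i ij.
  by rewrite eq_sym (negbTE ij).
have Gcomb y : to_real (G (comb y)) = to_real (pairing y).
  apply/le_anti; rewrite GF; apply/andP; split; first by apply: (FS (_, _)); exists y.
  pose y' n := rscale (-1) (y n).
  have /FS /= : S (comb y', to_real (pairing y')) by exists y'.
  rewrite /y' pairZ mulN1r -lerN2 opprK => /le_trans; apply.
  have -> : comb (fun n => rscale (-1) (y n)) = rscale (-1) (comb y).
    by apply/funext => i; rewrite combZ.
  by rewrite lF.2 mulN1r opprK.
exists f => [n|].
  apply: val_inj; apply/funext => x /=; apply/eqP; rewrite -subr_eq0.
  apply/eqP/to_real_eq0 => b.
  (* Only real parts are known to agree. Letting the scalar [b] vary in a test family supported at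
     [n] recovers the full equality. *)
  pose y m := if m == n then b *: x else 0.
  have py : pairing y = b * g n x.
    rewrite /pairing (bigD1 n)//= /y eqxx big1 ?addr0 ?linearZ// => m mn.
    by rewrite (negbTE mn) linear0.
  rewrite mulrBr to_realD to_realN -py -Gcomb Gf.
  apply/eqP; rewrite subr_eq0; apply/eqP; congr to_real.
  rewrite dual_sumE mulr_sumr; apply: eq_bigr => i _.
  rewrite /comb (bigD1 n)//= /y eqxx big1 ?addr0; last first.
    by move=> m mn; rewrite (negbTE mn) scaler0.
  by rewrite !linearZ; exact: mulrCA.
apply/ler_addgt0Pr => e e0.
(* Each [f i] is almost normed by a unit vector; after a phase rotation these vectors form one
   element of max norm at most 1, at which [G] takes the sum of the moduli. The [+ 1] covers an
   empty [I]. *)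
have e'0 : 0 < e / (#|I|%:R + 1) by rewrite divr_gt0// ltr_wpDl.
have /choice[x xP] (i : I) : exists x : X, rnorm x <= 1 /\
    rnorm (f i) - e / (#|I|%:R + 1) <= rnorm (f i x).
  have [_ [x /= x1 <-] xf] := sup_adherent e'0 (dual_has_sup (f i)).
  by exists x; split=> //; rewrite dual_normE ltW.
have /choice[b bP] (i : I) := rnorm_phase (f i (x i)).
have : \sum_i rnorm (f i (x i)) <= C.
  have -> : \sum_i rnorm (f i (x i)) = to_real (G (fun i => b i *: x i)).
    rewrite Gf to_real_sum; apply: eq_bigr => i _.
    have -> : f i (b i *: x i) = b i * f i (x i) :> K by exact: linearZ.
    by rewrite (bP i).2 of_realK.
  rewrite (le_trans (ler_to_real _))// (le_trans (GC _))//.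
  rewrite -[leRHS]mulr1 ler_wpM2l//; apply: maxnorm_le => // i.
  by rewrite rnormZ -[leRHS]mulr1 ler_pM ?rnorm_ge0 ?(bP i).1 ?(xP i).1.
move=> Cge; rewrite -lerBlDr (le_trans _ Cge)// lerBlDr.
apply: (@le_trans _ _ (\sum_i (rnorm (f i (x i)) + e / (#|I|%:R + 1)))).
  by apply: ler_sum => i _; rewrite -lerBlDr (xP i).2.
rewrite big_split lerD2l sumr_const -[leLHS]mulr_natr -[leLHS]mulrA ler_piMr ?ltW//.
by rewrite ltr_pdivrMl ?mulr1 ?ltrDl// ltr_wpDl.
Qed.

End decomposition.

(** * Finite-dimensional l_p norms *)

Section lp_norm.
Context {R : realType}.
Variables (p : R) (p1 : 1 <= p).
Let p0 : 0 < p. Proof. exact: lt_le_trans p1. Qed.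
Let pN0 : p != 0. Proof. by rewrite gt_eqF. Qed.

Definition lpnorm (I : finType) (t : I -> R) : R := (\sum_i t i `^ p) `^ p^-1.

Section theory.
Variable I : finType.
Implicit Types s t c : I -> R.

Lemma lpnorm_ge0 t : 0 <= lpnorm t.
Proof. exact: powR_ge0. Qed.

Lemma sum_powR_ge0 t : 0 <= \sum_i t i `^ p.
Proof. by apply: sumr_ge0 => i _; exact: powR_ge0. Qed.

Lemma lpnorm_powR t : lpnorm t `^ p = \sum_i t i `^ p.
Proof. by rewrite -powRrM mulVf// powRr1// sum_powR_ge0. Qed.

Lemma lpnorm_le t (C : R) : 0 <= C ->
  (lpnorm t <= C) = (\sum_i t i `^ p <= C `^ p).
Proof.
move=> C0; apply/idP/idP => H.
  by rewrite -lpnorm_powR ge0_ler_powR ?nnegrE ?lpnorm_ge0// ltW.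
have -> : C = (C `^ p) `^ p^-1 by rewrite -powRrM mulfV// powRr1.
by rewrite ge0_ler_powR ?nnegrE ?powR_ge0 ?sum_powR_ge0// invr_ge0 ltW.
Qed.

Lemma lpnorm_ub t i : 0 <= t i -> t i <= lpnorm t.
Proof.
move=> ti0; rewrite leNgt; apply/negP => lt_ti.
have : t i `^ p <= lpnorm t `^ p.
  rewrite lpnorm_powR (bigD1 i)//= lerDl sumr_ge0// => j _; exact: powR_ge0.
by rewrite leNgt gt0_ltr_powR// nnegrE ?lpnorm_ge0.
Qed.

(** Young's inequality for the exponents [p / (p - 1)] and [p]. At [p = 1], where the first one is
    undefined, the convention that [a] to the power 0 is 1 makes it an equality. *)
Lemma powR_young (a b : R) : 0 <= a -> 0 <= b ->
  a `^ (p - 1) * b <= (1 - p^-1) * a `^ p + p^-1 * b `^ p.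
Proof.
move=> a0 b0; have [p_eq1|pN1] := eqVneq p 1.
  by rewrite p_eq1 subrr powRr0 invr1 subrr mul0r add0r !mul1r powRr1.
have pm1 : 0 < p - 1 by rewrite subr_gt0 lt_neqAle eq_sym pN1.
have q0 : 0 < p / (p - 1) by rewrite divr_gt0.
have qE : (p / (p - 1))^-1 = 1 - p^-1 by rewrite invf_div mulrBl mulfV// mul1r.
have := @conjugate_powR _ (a `^ (p - 1)) b _ _ (powR_ge0 _ _) b0 q0 p0.
rewrite qE subrK => /(_ erefl)/le_trans; apply.
by rewrite -powRrM mulrCA mulfV ?gt_eqF// mulr1 [in leLHS]mulrC [b `^ p * _]mulrC.
Qed.

Lemma lpnormZ (a : R) t : 0 <= a -> (forall i, 0 <= t i) ->
  lpnorm (fun i => a * t i) = a * lpnorm t.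
Proof.
move=> a0 t0; rewrite /lpnorm; under eq_bigr do rewrite powRM//.
rewrite -mulr_sumr powRM ?powR_ge0 ?sum_powR_ge0//.
by rewrite -powRrM mulfV// powRr1.
Qed.

(** The equality case of Hoelder: for [u = t / lpnorm t] the weights are [u i] to the power [p - 1],
    and Young's inequality summed over normalized [u] and [s] gives the bound. The last clause says
    that [c] lies in the dual unit ball without naming the conjugate exponent, so [p = 1] is
    included. *)
Lemma lpnorm_dual t : (forall i, 0 <= t i) -> exists c,
  [/\ forall i, 0 <= c i, \sum_i c i * t i = lpnorm t &
      forall s, (forall i, 0 <= s i) -> \sum_i c i * s i <= lpnorm s].
Proof.
move=> t0; have := lpnorm_ge0 t; rewrite le_eqVlt => /predU1P[N0|N0].
  exists (fun=> 0); split=> // [|s s0].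
    by rewrite -N0 big1// => i _; rewrite mul0r.
  by rewrite big1 ?lpnorm_ge0// => i _; rewrite mul0r.
pose u i := (lpnorm t)^-1 * t i.
have uge0 i : 0 <= u i by rewrite mulr_ge0// invr_ge0 ltW.
have u1 : \sum_i u i `^ p = 1.
  rewrite -lpnorm_powR lpnormZ//; last by rewrite invr_ge0 ltW.
  by rewrite mulVf ?gt_eqF// powR1.
exists (fun i => u i `^ (p - 1)); split=> [i||s s0]; first exact: powR_ge0.
  transitivity (lpnorm t * \sum_i u i `^ p); last by rewrite u1 mulr1.
  rewrite mulr_sumr; apply: eq_bigr => i _.
  have -> : t i = lpnorm t * u i by rewrite mulrA mulfV ?gt_eqF// mul1r.
  rewrite -(mulr_powRB1 (uge0 i) p0).
  by move: (u i `^ (p - 1)) (u i) (lpnorm t) => A B D; rewrite mulrC -mulrA.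
have := lpnorm_ge0 s; rewrite le_eqVlt => /predU1P[s0'|M0].
  rewrite -s0' big1// => i _; suff -> : s i = 0 by rewrite mulr0.
  by apply/le_anti; rewrite s0 s0' lpnorm_ub.
rewrite -[leRHS]mulr1 -ler_pdivrMl// mulr_sumr.
apply: (@le_trans _ _ (\sum_i ((1 - p^-1) * u i `^ p +
    p^-1 * ((lpnorm s)^-1 * s i) `^ p))).
  apply: ler_sum => i _; rewrite [leLHS]mulrCA; apply: powR_young => //.
  by rewrite mulr_ge0// invr_ge0 ltW.
rewrite big_split/= -!mulr_sumr u1 -lpnorm_powR lpnormZ//.
  by rewrite mulVf ?gt_eqF// powR1 !mulr1 subrK.
by rewrite invr_ge0 ltW.
Qed.

End theory.
End lp_norm.

(** * Finite norming sets for [l_p] *)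

Section norming_net.
Context {R : realType}.

Lemma real_net (d : R) : 0 < d -> exists (J : finType) (e : J -> R),
  forall z, `|z| <= 1 -> exists j, `|z - e j| <= d.
Proof.
move=> d0; pose m := (Num.truncn d^-1).+1.
have m0 : 0 < m%:R :> R by rewrite ltr0n.
have dm : m%:R^-1 <= d.
  by rewrite -[leRHS]invrK lef_pV2 ?posrE ?invr_gt0// ltW// truncnS_gt.
exists 'I_(m.*2.+1), (fun j : 'I_(m.*2.+1) => j%:R / m%:R - 1) => z.
rewrite ler_norml => /andP[z1 z2].
have zm : 0 <= (z + 1) * m%:R by rewrite mulr_ge0// -lerBlDr sub0r.
have jm : (Num.truncn ((z + 1) * m%:R) < m.*2.+1)%N.
  rewrite ltnS -(ler_nat R) (@le_trans _ _ ((z + 1) * m%:R)) ?truncn_le//.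
  by rewrite -muln2 natrM mulrC ler_wpM2l// -lerBrDr; lra.
exists (Ordinal jm) => /=.
apply: le_trans dm; rewrite -(ler_pM2r m0) mulVf ?gt_eqF//.
rewrite -[X in _ * X <= _]ger0_norm// -normrM opprB addrA mulrBl mulfVK ?gt_eqF//.
rewrite ler_norml; have := truncn_itv zm; rewrite -natr1 => /andP[? ?].
by apply/andP; split; lra.
Qed.

Variable k : scalar_kind.
Local Notation K := (scalars R k).

Lemma scalar_net (d : R) : 0 < d -> exists (J : finType) (e : J -> K),
  forall z : K, rnorm (z : K^o) <= 1 -> exists j, rnorm (z - e j : K^o) <= d.
Proof.
rewrite /rnorm; case: k => d0; first exact: real_net.
have d20 : 0 < d / 2 by rewrite divr_gt0.
have [J [e eP]] := real_net d20.
exists (J * J)%type, (fun j => Complex (e j.1) (e j.2)) => -[x y] /= xy.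
have [i xi] : exists i, `|x - e i| <= d / 2.
  by apply/eP/(le_trans _ xy); rewrite -sqrtr_sqr ler_wsqrtr// lerDl sqr_ge0.
have [j yj] : exists j, `|y - e j| <= d / 2.
  by apply/eP/(le_trans _ xy); rewrite -sqrtr_sqr ler_wsqrtr// lerDr sqr_ge0.
exists (i, j) => /=; rewrite -[leRHS](ger0_norm (ltW d0)) -sqrtr_sqr ler_wsqrtr//.
move: xi yj; rewrite !ler_norml => /andP[? ?] /andP[? ?]; nra.
Qed.

(* The vectors [a i] are the points of a fine grid, rescaled into the dual
   unit ball when they are close to it. *)
Lemma lpnorm_norming_net (J : finType) (p e : R) : 1 <= p -> 0 < e ->
  exists (I : finType) (a : I -> J -> K),
    (forall i (v : J -> K), rnorm (\sum_n a i n * v n : K^o) <=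
        lpnorm p (fun n => rnorm (v n : K^o))) /\
    (forall v : J -> K, (forall i, rnorm (\sum_n a i n * v n : K^o) <= 1) ->
        lpnorm p (fun n => rnorm (v n : K^o)) <= 1 + e).
Proof.
move=> p1 e0; pose N (v : J -> K) := lpnorm p (fun n => rnorm (v n : K^o)).
(* The final estimate is [N v <= (1 + eta) + eta * N v], and this value solves
   [(1 + eta) / (1 - eta) = 1 + e]. *)
pose eta := e / (2 + e).
have eta0 : 0 < eta by rewrite divr_gt0// addr_gt0.
have eta1 : eta < 1 by rewrite ltr_pdivrMr ?addr_gt0// mul1r ltrDr.
(* A coordinatewise error [d] adds up to at most [#|J| * d <= eta] times [N u]. *)
pose d := eta / (#|J|%:R + 1).
have d0 : 0 < d by rewrite divr_gt0// ltr_wpDl.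
have Jd : #|J|%:R * d <= eta.
  by rewrite mulrCA ler_piMr ?ltW// ltr_pdivrMr ?mul1r ?ltrDl// ltr_wpDl.
have [G [g gP]] := scalar_net d0.
(* Grid points outside [1 + eta] times the dual ball are replaced by zero, for which the first bound
   is trivial; the index type thus remains all of [{ffun J -> G}]. *)
pose good (w : {ffun J -> G}) := `[< forall v : J -> K,
  rnorm (\sum_n g (w n) * v n : K^o) <= (1 + eta) * N v >].
exists {ffun J -> G}, (fun w n =>
  if good w then of_real k (1 + eta)^-1 * g (w n) else 0).
have aE w v : good w ->
    rnorm (\sum_n of_real k (1 + eta)^-1 * g (w n) * v n : K^o) =
    (1 + eta)^-1 * rnorm (\sum_n g (w n) * v n : K^o).
  move=> _; under eq_bigr do rewrite -mulrA.
  by rewrite -mulr_sumr rnormM rnorm_of ger0_norm// invr_ge0 addr_ge0// ltW.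
have eta10 : 0 < 1 + eta by rewrite addr_gt0.
split=> [w v|v av].
  case: (boolP (good w)) => gw; last first.
    by rewrite big1 ?rnorm0 ?lpnorm_ge0// => n _; rewrite mul0r.
  by rewrite aE// ler_pdivrMl//; move/asboolP: gw; exact.
have [c [c0 cv cs]] := lpnorm_dual p1 (fun n => rnorm_ge0 (v n : K^o)).
(* Testing [c] on the indicator of [n] brings each coordinate into the unit disc covered by the
   scalar net. *)
have c1 n : c n <= 1.
  have := cs (fun m => (m == n)%:R) (fun=> ler0n _ _).
  rewrite (bigD1 n)//= eqxx mulr1 big1 ?addr0 => [/le_trans|m /negbTE ->]; last first.
    by rewrite mulr0.
  apply; rewrite lpnorm_le// powR1 (bigD1 n)//= eqxx powR1 big1 ?addr0//.
  by move=> m /negbTE ->; rewrite powR0 ?gt_eqF// (lt_le_trans ltr01).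
have /choice[ph phP] (n : J) := rnorm_phase (v n).
pose b n := of_real k (c n) * ph n.
have bn n : rnorm (b n : K^o) <= c n.
  by rewrite rnormM rnorm_of ger0_norm// ler_piMr// (phP n).1.
have /choice[w wP] (n : J) := gP _ (le_trans (bn n) (c1 n)).
pose f := [ffun n => w n].
have gap u : rnorm (\sum_n b n * u n - \sum_n g (f n) * u n : K^o) <= eta * N u.
  rewrite -sumrB (le_trans (rnorm_sum _ _ _))//.
  apply: (@le_trans _ _ (\sum_(n : J) d * N u)); last first.
    rewrite sumr_const -[leLHS]mulr_natl mulrA ler_wpM2r//; exact: lpnorm_ge0.
  apply: ler_sum => n _; rewrite -mulrBl rnormM ffunE.
  rewrite ler_pM ?rnorm_ge0//.
  exact: (@lpnorm_ub _ _ p1 _ (fun n => rnorm (u n : K^o)) n (rnorm_ge0 _)).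
have bu u : rnorm (\sum_n b n * u n : K^o) <= N u.
  rewrite (le_trans (rnorm_sum _ _ _))//.
  apply: le_trans (cs _ (fun n => rnorm_ge0 (u n : K^o))).
  by apply: ler_sum => n _; rewrite rnormM ler_wpM2r ?rnorm_ge0.
have gf : good f.
  apply/asboolP => u; rewrite mulrDl mul1r.
  rewrite -[X in rnorm X](subrK (\sum_n b n * u n : K)) addrC.
  rewrite (le_trans (ler_rnormD _ _))// lerD//.
  by rewrite -[leLHS]rnormN opprB.
have := av f; rewrite gf aE// ler_pdivrMl// mulr1 => gv.
have bv : \sum_n b n * v n = of_real k (N v).
  rewrite /N -cv (big_morph _ (@of_realD R k) (@of_real0 R k)).
  by apply: eq_bigr => n _; rewrite -mulrA (phP n).2 of_realM.
have : N v <= (1 + eta) + eta * N v.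
  rewrite -[leLHS]ger0_norm ?lpnorm_ge0// -(@rnorm_of _ k) -bv.
  rewrite -[X in rnorm X](subrK (\sum_n g (f n) * v n : K)) addrC.
  by rewrite (le_trans (ler_rnormD _ _))// lerD.
have etaE : eta * (2 + e) = e by rewrite mulfVK// gt_eqF// addr_gt0.
rewrite -/(N v); have := lpnorm_ge0 p (fun n => rnorm (v n : K^o)).
by rewrite -/(N v) => ? ?; nra.
Qed.

End norming_net.

(** * Duality for the mid norm *)

Section helly.
Context {R : realType} {k : scalar_kind}.
Local Notation K := (scalars R k).

Lemma rnorm_dual_le1 (Z : normedModType K) (f : dual Z) (z : Z) :
  rnorm f <= 1 -> rnorm z <= 1 -> rnorm (f z) <= 1.
Proof.
by rewrite dual_normE => f1 z1; rewrite (le_trans (dual_norm_ub _ z1)).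
Qed.

Lemma sum_dual_rscale (J : finType) (Z : normedModType K) (g : J -> dual Z)
    (t : R) (x : J -> Z) :
  to_real (\sum_n (g n (rscale t (x n)) : K)) =
  t * to_real (\sum_n (g n (x n) : K)).
Proof.
rewrite -to_real_ofM mulr_sumr; congr to_real.
by apply: eq_bigr => n _; rewrite /rscale linearZ.
Qed.

Lemma rnorm_dual_rscale (Z : normedModType K) (f : dual Z) (t : R) (z : Z) :
  rnorm (f (rscale t z)) = `|t| * rnorm (f z).
Proof. by rewrite -rnorm_rscale /rscale linearZ. Qed.

(* A finite norming net of [l_p^J] identifies the weak [p]-norm on [X^J], up to
   a factor [1 + e], with a max norm of finitely many combinations, to which
   [dual_decomposition] applies. *)
Lemma helly_weak_ball (J : finType) (X : normedModType K) (p : R) (C : R)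
    (g : J -> dual X) (phi : J -> dual (dual X)) :
  1 <= p -> 0 <= C ->
  (forall f : dual X, rnorm f <= 1 -> \sum_n rnorm (phi n f) `^ p <= 1) ->
  (forall x : J -> X,
    (forall f : dual X, rnorm f <= 1 -> \sum_n rnorm (f (x n)) `^ p <= 1) ->
    to_real (\sum_n (g n (x n) : K)) <= C) ->
  to_real (\sum_n (phi n (g n) : K)) <= C.
Proof.
move=> p1 C0 phi1 gC; apply/ler_addgt0Pr => e' e'0.
have [e e0 eE] : exists2 e, 0 < e & (1 + e) * C <= C + e'.
  exists (e' / (C + 1)); first by rewrite divr_gt0// ltr_wpDl.
  rewrite mulrDl mul1r lerD2l -mulrA ler_piMr ?(ltW e'0)//.
  by rewrite ler_pdivrMl ?mulr1 ?lerDl// ltr_wpDl.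
apply: le_trans eE; have e10 : 0 < 1 + e by rewrite addr_gt0.
have [I [a [a1 a2]]] := @lpnorm_norming_net R k J p e p1 e0.
(* If all net combinations of [x] have norm at most 1, then [x] has weak norm at most [1 + e], so
   the hypothesis on [g] applies to [x] scaled by [(1 + e)^-1]. *)
have [|x xa|f gf fC] := @dual_decomposition _ _ X I J a g ((1 + e) * C).
- by rewrite mulr_ge0// ltW.
- rewrite -ler_pdivrMl// -sum_dual_rscale; apply: gC => f f1.
  suff: lpnorm p (fun n => rnorm (f (rscale (1 + e)^-1 (x n)))) <= 1.
    by rewrite lpnorm_le// powR1.
  rewrite (_ : (fun n => _) = fun n => (1 + e)^-1 * rnorm (f (x n))); last first.
    by apply/funext => n; rewrite rnorm_dual_rscale gtr0_norm ?invr_gt0.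
  rewrite lpnormZ ?invr_ge0 ?(ltW e10)//; last by move=> n; exact: rnorm_ge0.
  rewrite ler_pdivrMl// mulr1; apply: a2 => i.
  have := rnorm_dual_le1 f1 (xa i); rewrite linear_sum.
  by under eq_bigr do rewrite linearZ.
have phi_le f' : lpnorm p (fun n => rnorm (phi n f')) <= rnorm f'.
  have := rnorm_ge0 f'; rewrite le_eqVlt => /predU1P[f0|f0].
    rewrite -f0 lpnorm_le// powR0 ?gt_eqF ?(lt_le_trans ltr01)// big1// => n _.
    rewrite (rnorm_eq0 (esym f0)) linear0 rnorm0 powR0//.
    by rewrite gt_eqF ?(lt_le_trans ltr01).
  rewrite -[leRHS]mulr1 -ler_pdivrMl// -lpnormZ// ?invr_ge0 ?(ltW f0)//; last first.
    by move=> n; exact: rnorm_ge0.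
  rewrite lpnorm_le// powR1.
  have := phi1 (rscale (rnorm f')^-1 f').
  rewrite rnorm_rscale gtr0_norm ?invr_gt0// mulVf ?gt_eqF// => /(_ (lexx _)).
  under eq_bigr do rewrite rnorm_dual_rscale gtr0_norm ?invr_gt0//.
  by [].
apply: le_trans fC; rewrite (le_trans (ler_to_real _))//.
(* The decomposition of [g] moves [phi] onto the vectors [f i], where the first property of the net
   and [phi_le] bound each inner sum by [rnorm (f i)]. *)
have -> : \sum_n (phi n (g n) : K) = \sum_i \sum_n a i n * phi n (f i).
  rewrite exchange_big; apply: eq_bigr => n _; rewrite gf linear_sum.
  by apply: eq_bigr => i _; rewrite linearZ.
rewrite (le_trans (rnorm_sum _ _ _))//; apply: ler_sum => i _.
exact: le_trans (a1 _ _) (phi_le _).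
Qed.

End helly.

(** * Series of nonnegative terms and extended reals *)

Section series.
Context {R : realType}.
Implicit Types u : nat -> R.

Lemma nneseries_leP u (c : R) : (forall n, 0 <= u n) ->
  (\sum_(j <oo) (u j)%:E <= c%:E)%E <-> forall N, \sum_(j < N) u j <= c.
Proof.
move=> u0; split=> [uc N|uc].
  rewrite -lee_fin -sumEFin (le_trans _ uc)// -(big_mkord xpredT (fun j => (u j)%:E)).
  by apply: nneseries_lim_ge => n _ _; rewrite lee_fin.
apply: lime_le; first by apply: is_cvg_nneseries => n _ _; rewrite lee_fin.
by near=> N; rewrite big_mkord sumEFin lee_fin.
Unshelve. all: by end_near. Qed.

Lemma sum_finite_support u (N M : nat) : (forall n, 0 <= u n) ->
  (forall n, (N <= n)%N -> u n = 0) -> \sum_(j < M) u j <= \sum_(j < N) u j.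
Proof.
move=> u0 uN; have [MN|/ltnW NM] := leqP M N.
  rewrite -!(big_mkord xpredT u) (big_cat_nat _ MN)//= lerDl.
  by apply: sumr_ge0 => j _; exact: u0.
rewrite -!(big_mkord xpredT u) (big_cat_nat _ NM)//= gerDl.
by rewrite big_nat big1// => j /andP[Nj _]; exact: uN.
Qed.

Lemma poweR_inv_le (p c : R) (S : \bar R) : 0 < p -> 0 <= c -> (0 <= S)%E ->
  (S `^ p^-1 <= c%:E)%E = (S <= (c `^ p)%:E)%E.
Proof.
move=> p0 c0; case: S => [s| |]//; rewrite ?lee_fin => s0; last first.
  by rewrite poweRyr ?invr_eq0 ?gt_eqF// !leye_eq.
apply/idP/idP => H.
  have -> : s = (s `^ p^-1) `^ p by rewrite -powRrM mulVf ?gt_eqF// powRr1.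
  by rewrite ge0_ler_powR ?nnegrE ?powR_ge0 ?(ltW p0).
have -> : c = (c `^ p) `^ p^-1 by rewrite -powRrM mulfV ?gt_eqF// powRr1.
by rewrite ge0_ler_powR ?nnegrE ?powR_ge0 ?invr_ge0 ?(ltW p0).
Qed.

Lemma lee_scale_fin (t c : R) (S : \bar R) : 0 < t ->
  (S <= c%:E)%E -> (t%:E * S <= (t * c)%:E)%E.
Proof.
by move=> t0 Sc; rewrite EFinM; apply: lee_wpmul2l => //; rewrite lee_fin ltW.
Qed.

Lemma lty_le_fin (S : \bar R) : (S < +oo)%E ->
  exists2 c : R, 0 <= c & (S <= c%:E)%E.
Proof.
case: S => [r _| |_]; rewrite ?ltxx//; last by exists 0; rewrite ?leNye.
by exists `|r|; rewrite // lee_fin ler_norm.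
Qed.

Lemma ge0_eq_le_fin (a b : \bar R) : (0 <= a)%E -> (0 <= b)%E ->
  (forall C : R, 0 <= C -> (a <= C%:E)%E <-> (b <= C%:E)%E) -> a = b.
Proof.
move=> /gee0P[->|[r r0 ->]] /gee0P[->|[s s0 ->]] // H.
- by have := (H s s0).2 (lexx _).
- by have := (H r r0).1 (lexx _).
- apply/le_anti/andP; split; first exact: (H s s0).2 (lexx _).
  exact: (H r r0).1 (lexx _).
Qed.

End series.

(** * The canonical embedding into the bidual *)

Section bidual_embedding.
Context {R : realType} {k : scalar_kind}.
Local Notation K := (scalars R k).

Lemma rnorm_dual_le (V : normedModType K) (f : dual V) (z : V) :
  rnorm (f z) <= rnorm f * rnorm z.
Proof.
have [->|z0] := eqVneq z 0; first by rewrite linear0 !rnorm0 mulr0.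
have zgt0 : 0 < rnorm z.
  by rewrite lt_neqAle rnorm_ge0 andbT eq_sym; apply: contra z0 => /eqP/rnorm_eq0/eqP.
rewrite mulrC -ler_pdivrMl// dual_normE -[_^-1]gtr0_norm ?invr_gt0//.
rewrite -rnorm_dual_rscale dual_norm_ub// rnorm_rscale gtr0_norm ?invr_gt0//.
by rewrite mulVf// gt_eqF.
Qed.

Variable Z : normedModType K.

Let eval (z : Z) (f : dual Z) : K^o := f z.

Let eval_bound z f : rnorm (eval z f) <= rnorm z * rnorm f.
Proof. by rewrite mulrC; exact: rnorm_dual_le. Qed.


Definition bidual (z : Z) : dual (dual Z) :=
  Dual (continuous_functionalP (fun _ _ _ => erefl) (eval_bound z)).

Lemma rnorm_bidual z : rnorm (bidual z) <= rnorm z.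
Proof.
rewrite dual_normE; apply: dual_norm_le => f f1.
by rewrite (le_trans (eval_bound z f))// ler_piMr// rnorm_ge0.
Qed.

Lemma dual_bidual (F : dual (dual (dual Z))) : rnorm F <= 1 ->
  exists2 f : dual Z, rnorm f <= 1 & forall z, f z = F (bidual z).
Proof.
move=> F1; have lF : linear (fun z => F (bidual z)).
  move=> a u v; rewrite -linearP; congr (F _); apply: val_inj; apply/funext => f.
  by rewrite /= /eval linearP.
have FM z : rnorm (F (bidual z)) <= 1 * rnorm z.
  rewrite (le_trans _ (_ : rnorm F * rnorm (bidual z) <= _))//.
    exact: rnorm_dual_le.
  by rewrite ler_pM ?rnorm_ge0// rnorm_bidual.
exists (Dual (continuous_functionalP lF FM)) => //.
by rewrite dual_normE; apply: dual_norm_le => z z1; rewrite (le_trans (FM z))// mul1r.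
Qed.

End bidual_embedding.

(** * Norm bounds through finite partial sums *)

Section summability.
Context {R : realType} {k : scalar_kind}.
Local Notation K := (scalars R k).
Variables (p : R) (p1 : 1 <= p).
Let p0 : 0 < p. Proof. exact: lt_le_trans p1. Qed.

Lemma weak_norm_leP (Z : normedModType K) (z : nat -> Z) (c : R) : 0 <= c ->
  (weak_norm p%:E z <= c%:E)%E <->
  forall f : dual Z, rnorm f <= 1 ->
    forall N, \sum_(j < N) rnorm (f (z j)) `^ p <= c `^ p.
Proof.
move=> c0; have u0 (f : dual Z) n : 0 <= rnorm (f (z n)) `^ p by exact: powR_ge0.
split=> [H f f1|H].
  apply/(nneseries_leP _ (u0 f)).
  rewrite -poweR_inv_le//; last first.
    by apply: nneseries_ge0 => n _ _; rewrite lee_fin powR_ge0.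
  by apply: le_trans H; apply: ereal_sup_ubound; exists f.
apply: ge_ereal_sup => _ [f f1 <-]; rewrite poweR_inv_le//; last first.
  by apply: nneseries_ge0 => n _ _; rewrite lee_fin powR_ge0.
by apply/(nneseries_leP _ (u0 f)); exact: H.
Qed.

Lemma mid_sum_ge0 (Z : normedModType K) (f : nat -> dual Z) (z : nat -> Z) :
  (0 <= mid_sum p f z)%E.
Proof.
apply: nneseries_ge0 => n _ _; apply: nneseries_ge0 => j _ _.
by rewrite lee_fin powR_ge0.
Qed.

Lemma mid_sum_leP (Z : normedModType K) (f : nat -> dual Z) (z : nat -> Z)
    (c : R) :
  (mid_sum p f z <= c%:E)%E <->
  forall M N, \sum_(n < M) \sum_(j < N) rnorm (f n (z j)) `^ p <= c.
Proof.
have t0 n j : (0 <= (rnorm (f n (z j)) `^ p)%:E)%E by rewrite lee_fin powR_ge0.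
have T0 n : (0 <= \sum_(j <oo) (rnorm (f n (z j)) `^ p)%:E)%E.
  exact: nneseries_ge0.
split=> [H M N|H].
  rewrite -lee_fin (le_trans _ H)// -sumEFin.
  apply: le_trans (nneseries_lim_ge M (fun n _ _ => T0 n)).
  rewrite big_mkord; apply: lee_sum => n _; rewrite -sumEFin.
  rewrite -(big_mkord xpredT (fun j => (rnorm (f n (z j)) `^ p)%:E)).
  exact: nneseries_lim_ge.
apply: lime_le; first exact: is_cvg_nneseries.
(* For fixed [M] the finite sum passes inside the series, so the two limits are taken one after the
   other. *)
near=> M; rewrite -nneseries_sum_nat//.
apply: lime_le.
  by apply: is_cvg_nneseries => j _ _; rewrite sume_ge0.
near=> N; rewrite exchange_big big_mkord.
under eq_bigr do rewrite big_mkord sumEFin.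
by rewrite sumEFin lee_fin.
Unshelve. all: by end_near. Qed.

Lemma mid_norm_leP (Z : normedModType K) (z : nat -> Z) (c : R) : 0 <= c ->
  (seq_norm (ell_mid p Z) z <= c%:E)%E <->
  forall f : nat -> dual Z, seq_ball (ell_weak p%:E (dual Z)) f ->
    (mid_sum p f z <= (c `^ p)%:E)%E.
Proof.
move=> c0; split=> [H f fB|H].
  rewrite -poweR_inv_le ?mid_sum_ge0//.
  by apply: le_trans H; apply: ereal_sup_ubound; exists f.
by apply: ge_ereal_sup => _ [f fB <-]; rewrite poweR_inv_le ?mid_sum_ge0//; exact: H.
Qed.

Lemma pairing_sum_leP (Z : normedModType K) (f : nat -> dual Z) (z : nat -> Z)
    (c : R) :
  (pairing_sum f z <= c%:E)%E <->
  forall N, \sum_(j < N) rnorm (f j (z j)) <= c.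
Proof. exact: nneseries_leP (fun n => rnorm_ge0 _). Qed.

Lemma weak_ballP (Z : normedModType K) (z : nat -> Z) :
  seq_ball (ell_weak p%:E Z) z <-> (weak_norm p%:E z <= 1)%E.
Proof. by split=> [[]//|z1]; split=> //; rewrite /= (le_lt_trans z1) ?ltry. Qed.

Definition finite_seq (V : zmodType) (N : nat) (x : 'I_N -> V) (j : nat) : V :=
  if insub j is Some i then x i else 0.

Lemma finite_seq_ord (V : zmodType) (N : nat) (x : 'I_N -> V) (i : 'I_N) :
  finite_seq x i = x i.
Proof. by rewrite /finite_seq valK. Qed.

Lemma finite_seq_ge (V : zmodType) (N : nat) (x : 'I_N -> V) (j : nat) :
  (N <= j)%N -> finite_seq x j = 0.
Proof. by move=> Nj; rewrite /finite_seq insubF// ltnNge Nj. Qed.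

(** The weak norm in [dual (dual X)] is tested by the third dual, but by [dual_bidual] each such
    functional acts on the image of [X] as an element of the ball of [dual X]. *)
Lemma finite_seq_weak_ball (X : normedModType K) (M : nat) (x : 'I_M -> X) :
  (forall f : dual X, rnorm f <= 1 -> \sum_n rnorm (f (x n)) `^ p <= 1) ->
  seq_ball (ell_weak p%:E (dual (dual X))) (fun n => bidual (finite_seq x n)).
Proof.
move=> x1; apply/weak_ballP/(weak_norm_leP _ ler01) => F /dual_bidual[f f1 fF] N.
rewrite powR1 (le_trans _ (x1 f f1))//.
under eq_bigr do rewrite -fF.
apply: le_trans (@sum_finite_support _ (fun n => rnorm (f (finite_seq x n)) `^ p) M N _ _) _.
- by move=> n; exact: powR_ge0.
- by move=> n Mn; rewrite finite_seq_ge// linear0 rnorm0 powR0// gt_eqF.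
by under eq_bigr do rewrite finite_seq_ord.
Qed.

(* By duality in [l_p] and Helly's lemma it suffices to test the elements
   [y j = sum_n b (n, j) *: x n] with [b] in the ball of [l_p^*] and [x] in the
   weak [p]-ball, and these lie in the ball of [ell_mid_dual]. *)
Lemma sum_bidual_le (X : normedModType K) (h : nat -> dual X)
    (phi : nat -> dual (dual X)) (M N : nat) (C : R) : 0 <= C ->
  (forall f : dual X, rnorm f <= 1 ->
    \sum_(n < M) rnorm (phi n f) `^ p <= 1) ->
  (forall y, seq_ball (ell_mid_dual p X) y -> (pairing_sum h y <= C%:E)%E) ->
  \sum_(n < M) \sum_(j < N) rnorm (phi n (h j)) `^ p <= C `^ p.
Proof.
move=> C0 phi1 hC; rewrite pair_big/= -[leLHS]/(\sum_i _).
pose t (i : 'I_M * 'I_N) := rnorm (phi i.1 (h i.2)).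
rewrite -(@lpnorm_le _ p p1 _ t)//.
have [c [c0 <- cs]] := lpnorm_dual p1 (fun i => rnorm_ge0 _ : 0 <= t i).
have /choice[ph phP] (i : 'I_M * 'I_N) := rnorm_phase (phi i.1 (h i.2)).
pose b i := of_real k (c i) * ph i.
pose g (n : 'I_M) := \sum_j b (n, j) *: h j.
have -> : \sum_i c i * t i = to_real (\sum_(n < M) (phi n (g n) : K)).
  have -> : \sum_(n < M) (phi n (g n) : K) = \sum_i b i * phi i.1 (h i.2).
    transitivity (\sum_(n < M) \sum_(j < N) b (n, j) * phi n (h j)).
      apply: eq_bigr => n _; rewrite linear_sum; apply: eq_bigr => j _.
      by rewrite linearZ.
    by rewrite pair_bigA; apply: eq_bigr => -[].
  rewrite to_real_sum; apply: eq_bigr => i _.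
  by rewrite -mulrA (phP i).2 to_real_ofM of_realK.
apply: (helly_weak_ball p1 C0 phi1) => x x1.
pose y : nat -> X := finite_seq (fun j : 'I_N => \sum_n b (n, j) *: x n).
have yB (f : nat -> dual X) : (pairing_sum f y <=
    (\sum_(j < N) \sum_(n < M) c (n, j) * rnorm (f j (x n)))%:E)%E.
  apply/pairing_sum_leP => N'.
  apply: le_trans (@sum_finite_support _ (fun j => rnorm (f j (y j))) N N' _ _) _.
  - by move=> j; exact: rnorm_ge0.
  - by move=> j Nj; rewrite /y finite_seq_ge// linear0 rnorm0.
  apply: ler_sum => j _; rewrite /y finite_seq_ord linear_sum.
  rewrite (le_trans (rnorm_sum _ _ _))//; apply: ler_sum => n _.
  rewrite linearZ rnormZ ler_wpM2r ?rnorm_ge0// rnormM rnorm_of ger0_norm//.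
  by rewrite ler_piMr// (phP _).1.
(* Membership holds because [yB] bounds the pairing with any [f] by a finite sum. For the norm, [cs]
   reduces this sum to the [l_p] norm of the values [f j (x n)], whose [p]-th power is a partial sum
   of the mid sum of [f] tested on the images of [x] in the bidual. *)
have {}yB : seq_ball (ell_mid_dual p X) y.
  split=> [f _|]; first by rewrite (le_lt_trans (yB f))// ltry.
  apply: ge_ereal_sup => _ [f [_ f1] <-]; rewrite (le_trans (yB f))// lee_fin.
  rewrite exchange_big/= (pair_bigA _ (fun n j => c (n, j) * rnorm (f j (x n))))/=.
  apply: le_trans (_ : \sum_i c i * rnorm (f i.2 (x i.1)) <= _).
    by rewrite le_eqVlt; apply/orP; left; apply/eqP; apply: eq_bigr => -[].
  apply: le_trans (cs (fun i => rnorm (f i.2 (x i.1))) (fun i => rnorm_ge0 _)) _.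
  rewrite lpnorm_le// powR1.
  have /(mid_norm_leP _ ler01) := f1; move=> /(_ _ (finite_seq_weak_ball x1)).
  rewrite powR1 => /mid_sum_leP/(_ M N).
  under eq_bigr do under eq_bigr do rewrite finite_seq_ord.
  by rewrite pair_bigA.
have /pairing_sum_leP/(_ N) := hC y yB; apply: le_trans.
have -> : \sum_(n < M) (g n (x n) : K) = \sum_(j < N) (h j (y j) : K).
  under eq_bigr do rewrite dual_sumE.
  rewrite exchange_big; apply: eq_bigr => j _; rewrite /y finite_seq_ord linear_sum.
  by apply: eq_bigr => n _; rewrite linearZ.
by rewrite (le_trans (ler_to_real _))// rnorm_sum.
Qed.

End summability.

(** * Bounded maps between sequence spaces *)

Section bounded_maps.
Context {R : realType} {k : scalar_kind}.
Local Notation K := (scalars R k).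

Definition seq_scale (V : lmodType K) (t : R) (z : nat -> V) : nat -> V :=
  fun j => rscale t (z j).

Lemma seq_scaleK (V : lmodType K) (t : R) (z : nat -> V) : t != 0 ->
  seq_scale t^-1 (seq_scale t z) = z.
Proof.
by move=> t0; apply/funext => j; rewrite /seq_scale rscaleA mulVf// rscale1.
Qed.

Lemma seq_map_scale (V W : normedModType K) (u : {linear V -> W}) (t : R)
  (z : nat -> V) : seq_map u (seq_scale t z) = seq_scale t (seq_map u z).
Proof. by apply/funext => j; rewrite /seq_map /seq_scale /rscale linearZ. Qed.

(** The reverse inequality follows by applying this one to [t^-1]. *)
Definition norm_subhomogeneous (V : lmodType K) (E : seq_space R V) :=
  forall t z, 0 < t ->
    (seq_norm E (seq_scale t z) <= t%:E * seq_norm E z)%E.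

Record linear_domain (V : lmodType K) (E : seq_space R V) : Prop :=
  LinearDomain {
    linear_domain0 : seq_mem E 0 ;
    linear_domainB : forall x y, seq_mem E x -> seq_mem E y -> seq_mem E (x - y) ;
    linear_domainZ : forall t z, 0 < t -> seq_mem E z -> seq_mem E (seq_scale t z) ;
    linear_domain_norm : norm_subhomogeneous E }.

Variables (X Y : normedModType K) (E : seq_space R X) (F : seq_space R Y).
Hypotheses (hE : linear_domain E) (hF : norm_subhomogeneous F).
Variable u : {linear X -> Y}.

Definition ball_bound (C : R) :=
  forall z, seq_ball E z -> (seq_norm F (seq_map u z) <= C%:E)%E.

Lemma induced_continuous_bounded : induced_continuous E F u ->
  exists2 C, 0 <= C & ball_bound C.
Proof.
move=> /(_ _ (linear_domain0 hE) _ ltr01)[d d0 ud].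
have u0 : seq_map u 0 = 0 by apply/funext => j; rewrite /seq_map linear0.
(* Continuity at 0 is stated with a strict inequality, so the unit ball is shrunk by [d / 2] rather
   than by [d]. *)
have d20 : 0 < d / 2 by rewrite divr_gt0.
exists (d / 2)^-1 => [|z [zE z1]]; first by rewrite invr_ge0 ltW.
have := ud _ (linear_domainZ hE d20 zE); rewrite u0 !subr0 => /(_ _)/ltW H.
rewrite -(@seq_scaleK _ (d / 2) z) ?gt_eqF// seq_map_scale.
rewrite (le_trans (hF _ _))// ?invr_gt0//.
rewrite -[leRHS]mule1; apply: lee_wpmul2l; first by rewrite lee_fin invr_ge0 ltW.
apply: H; rewrite (le_lt_trans (linear_domain_norm hE _ d20))//.
rewrite (le_lt_trans (lee_scale_fin d20 z1))// mulr1 lte_fin.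
by rewrite ltr_pdivrMr// mulr_natr mulr2n ltrDl.
Qed.

Lemma bounded_induced_continuous (C : R) : 0 <= C -> ball_bound C ->
  induced_continuous E F u.
Proof.
move=> C0 uC x xE e e0; have C10 : 0 < C + 1 by rewrite ltr_wpDl.
(* This gives [d * C < e] even for [C = 0]. Rescaling the difference by [d^-1] puts it in the unit
   ball without dividing by its possibly zero norm. *)
pose d := e / (C + 1); have d0 : 0 < d by rewrite divr_gt0.
have dV : 0 < d^-1 by rewrite invr_gt0.
exists d => // x' x'E xd.
have -> : seq_map u x' - seq_map u x = seq_map u (x' - x).
  by apply/funext => j; rewrite /seq_map !fctE linearB.
have zE := linear_domainB hE x'E xE.
rewrite -(@seq_scaleK _ d^-1 (x' - x)) ?gt_eqF// invrK seq_map_scale.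
rewrite (le_lt_trans (hF _ _))//.
have H : (seq_norm F (seq_map u (seq_scale d^-1 (x' - x)%R)) <= C%:E)%E.
  apply: uC; split; first exact: linear_domainZ.
  rewrite (le_trans (linear_domain_norm hE _ _))//.
  by rewrite (le_trans (lee_scale_fin dV (ltW xd)))// mulVf ?gt_eqF.
rewrite (le_lt_trans (lee_scale_fin d0 H))// lte_fin.
by rewrite /d mulrAC ltr_pdivrMr// ltr_pM2l// ltrDl.
Qed.

End bounded_maps.

(** * Homogeneity and linearity of the sequence spaces *)

Section homogeneity.
Context {R : realType} {k : scalar_kind}.
Local Notation K := (scalars R k).
Variables (p : R) (p1 : 1 <= p).
Let p0 : 0 < p. Proof. exact: lt_le_trans p1. Qed.
Let pN0 : p != 0. Proof. by rewrite gt_eqF. Qed.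
Variable Z : normedModType K.
Implicit Types (z : nat -> Z) (f : nat -> dual Z) (t : R).

Lemma pairing_sumZr f z t : 0 < t ->
  pairing_sum f (seq_scale t z) = (t%:E * pairing_sum f z)%E.
Proof.
move=> t0; rewrite -nneseriesZl; last by move=> j _; rewrite lee_fin rnorm_ge0.
by apply: eq_eseriesr => j _; rewrite rnorm_dual_rscale gtr0_norm// EFinM.
Qed.

Lemma pairing_sumZl f z t : 0 < t ->
  pairing_sum (seq_scale t f) z = (t%:E * pairing_sum f z)%E.
Proof.
move=> t0; rewrite -(pairing_sumZr _ _ t0); apply: eq_eseriesr => j _.
by congr (_%:E); congr rnorm; rewrite /seq_scale /rscale linearZ.
Qed.

Lemma mid_sumZr f z t : 0 < t ->
  mid_sum p f (seq_scale t z) = ((t `^ p)%:E * mid_sum p f z)%E.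
Proof.
move=> t0; rewrite -nneseriesZl; last first.
  by move=> n _; apply: nneseries_ge0 => j _ _; rewrite lee_fin powR_ge0.
apply: eq_eseriesr => n _; rewrite -nneseriesZl; last first.
  by move=> j _; rewrite lee_fin powR_ge0.
apply: eq_eseriesr => j _; rewrite rnorm_dual_rscale gtr0_norm//.
by rewrite powRM ?rnorm_ge0 ?(ltW t0)// EFinM.
Qed.

Lemma mid_sumZl f z t : 0 < t ->
  mid_sum p (seq_scale t f) z = ((t `^ p)%:E * mid_sum p f z)%E.
Proof.
move=> t0; rewrite -(mid_sumZr _ _ t0); apply: eq_eseriesr => n _.
apply: eq_eseriesr => j _.
by congr ((_ `^ _)%:E); congr rnorm; rewrite /seq_scale /rscale linearZ.
Qed.

Let poweRZ t (S : \bar R) : 0 < t -> (0 <= S)%E ->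
  (((t `^ p)%:E * S) `^ p^-1 = t%:E * S `^ p^-1)%E.
Proof.
move=> t0 S0; rewrite poweRM ?lee_fin ?powR_ge0// poweR_EFin -powRrM mulfV//.
by rewrite powRr1// ltW.
Qed.

Lemma weak_norm_subhomogeneous : norm_subhomogeneous (ell_weak p%:E Z).
Proof.
move=> t z t0 /=; apply: ge_ereal_sup => _ [f f1 <-].
have -> : (\sum_(j <oo) (rnorm (f (seq_scale t z j)) `^ p)%:E =
    (t `^ p)%:E * \sum_(j <oo) (rnorm (f (z j)) `^ p)%:E)%E.
  rewrite -nneseriesZl; last by move=> j _; rewrite lee_fin powR_ge0.
  apply: eq_eseriesr => j _; rewrite rnorm_dual_rscale gtr0_norm//.
  by rewrite powRM ?rnorm_ge0 ?(ltW t0)// EFinM.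
rewrite poweRZ//; last by apply: nneseries_ge0 => j _ _; rewrite lee_fin powR_ge0.
apply: lee_wpmul2l; first by rewrite lee_fin ltW.
by apply: ereal_sup_ubound; exists f.
Qed.

Lemma mid_norm_subhomogeneous : norm_subhomogeneous (ell_mid p Z).
Proof.
move=> t z t0 /=; apply: ge_ereal_sup => _ [f fB <-].
rewrite mid_sumZr// poweRZ ?mid_sum_ge0//.
apply: lee_wpmul2l; first by rewrite lee_fin ltW.
by apply: ereal_sup_ubound; exists f.
Qed.

Lemma pairing_norm_subhomogeneous (E : seq_space R (dual Z)) :
  norm_subhomogeneous (pairing_dual E).
Proof.
move=> t z t0 /=; apply: ge_ereal_sup => _ [f fB <-]; rewrite pairing_sumZr//.
apply: lee_wpmul2l; first by rewrite lee_fin ltW.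
by apply: ereal_sup_ubound; exists f.
Qed.

Lemma mid_memZ z t : 0 < t -> seq_mem (ell_mid p Z) z ->
  seq_mem (ell_mid p Z) (seq_scale t z).
Proof.
move=> t0 zE f fE; rewrite mid_sumZr//; apply: lte_mul_pinfty => //; first last.
- exact: zE.
- by rewrite lee_fin powR_ge0.
Qed.

Lemma weak_linear_domain : linear_domain (ell_weak p%:E Z).
Proof.
split; last exact: weak_norm_subhomogeneous.
- rewrite /= (@le_lt_trans _ _ 0%:E) ?ltry//; apply/(weak_norm_leP p1) => // f _ N.
  by rewrite big1 ?powR_ge0// => j _; rewrite linear0 rnorm0 powR0.
- move=> x y /lty_le_fin[c c0 /(weak_norm_leP p1 _ c0) xc].
  move=> /lty_le_fin[d d0 /(weak_norm_leP p1 _ d0) yd] /=.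
  (* Only finiteness matters here, so Minkowski's inequality is replaced by the cruder comparison of
     [a + b] with twice the maximum of [a] and [b]. *)
  pose B := 2 `^ p * (c `^ p + d `^ p).
  have B0 : 0 <= B by rewrite mulr_ge0 ?addr_ge0 ?powR_ge0.
  rewrite (@le_lt_trans _ _ (B `^ p^-1)%:E) ?ltry//.
  apply/(weak_norm_leP p1 _ (powR_ge0 _ _)) => f f1 N.
  rewrite -powRrM mulVf// powRr1// /B.
  apply: le_trans (_ : \sum_(j < N) 2 `^ p *
    (rnorm (f (x j)) `^ p + rnorm (f (y j)) `^ p) <= _); last first.
    by rewrite -mulr_sumr ler_wpM2l ?powR_ge0// big_split lerD ?xc ?yd.
  apply: ler_sum => j _; rewrite !fctE linearB.
  set a := rnorm (f (x j)); set b := rnorm (f (y j)).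
  have a0 : 0 <= a by exact: rnorm_ge0.
  have b0 : 0 <= b by exact: rnorm_ge0.
  apply: (@le_trans _ _ ((2 * Num.max a b) `^ p)).
    rewrite ge0_ler_powR ?nnegrE ?(ltW p0) ?rnorm_ge0 ?mulr_ge0 ?le_max ?a0//.
    rewrite (le_trans (ler_rnormD _ _))// rnormN mulr_natl mulr2n.
    by rewrite lerD// le_max lexx ?orbT.
  rewrite powRM ?le_max ?a0// ler_wpM2l ?powR_ge0//.
  by case: (leP a b) => _; rewrite ?lerDl ?lerDr powR_ge0.
- move=> t z t0 /= zE; rewrite (le_lt_trans (weak_norm_subhomogeneous _ t0))//.
  have [c c0 zc] := lty_le_fin zE.
  by rewrite (le_lt_trans (lee_scale_fin t0 zc)) ?ltry.
Qed.

Lemma weak_scale_ball z : seq_mem (ell_weak p%:E Z) z ->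
  exists2 t, 0 < t & seq_ball (ell_weak p%:E Z) (seq_scale t z).
Proof.
move=> /lty_le_fin[c c0 zc]; have c10 : 0 < c + 1 by rewrite ltr_wpDl.
exists (c + 1)^-1; rewrite ?invr_gt0//; apply/(weak_ballP p).
have cV : 0 < (c + 1)^-1 by rewrite invr_gt0.
rewrite (le_trans (weak_norm_subhomogeneous _ cV))//.
rewrite (le_trans (lee_scale_fin cV zc))// lee_fin.
by rewrite ler_pdivrMl// mulr1 lerDl.
Qed.

Lemma weak_ball0 : seq_ball (ell_weak p%:E Z) 0.
Proof.
apply/weak_ballP/(weak_norm_leP p1 _ ler01) => f _ N.
by rewrite powR1 big1// => j _; rewrite linear0 rnorm0 powR0.
Qed.

Lemma pairing_linear_domain (E : seq_space R (dual Z)) :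
  linear_domain (pairing_dual E).
Proof.
split; last exact: pairing_norm_subhomogeneous.
- move=> f _ /=; rewrite [pairing_sum _ _]eseries0 ?ltry// => j _ _.
  by rewrite linear0 rnorm0.
- move=> x y xE yE f fE /=.
  apply: le_lt_trans (lte_add_pinfty (xE f fE) (yE f fE)).
  rewrite -nneseriesD; [|by move=> j _ _; rewrite lee_fin rnorm_ge0..].
  apply: lee_nneseries => [j _ _|j _]; rewrite lee_fin ?rnorm_ge0//.
  by rewrite !fctE linearB (le_trans (ler_rnormD _ _))// rnormN.
- move=> t z t0 zE f fE; rewrite pairing_sumZr//; apply: lte_mul_pinfty => //.
    by rewrite lee_fin ltW.
  exact: zE.
Qed.

(* Scaling by [C + e] rather than by the norm avoids a case distinction on
   the norm being zero. *)
Lemma pairing_sum_le_norm f z (E : seq_space R (dual Z)) (C : R) :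
  (forall t f', 0 < t -> seq_mem E f' -> seq_mem E (seq_scale t f')) ->
  norm_subhomogeneous E -> 0 <= C ->
  seq_mem E f -> (seq_norm E f <= C%:E)%E -> seq_ball (pairing_dual E) z ->
  (pairing_sum f z <= C%:E)%E.
Proof.
move=> EZ EN C0 fE fC [_ z1]; apply/lee_addgt0Pr => e e0.
have Ce : 0 < C + e by rewrite ltr_wpDl.
have CeV : 0 < (C + e)^-1 by rewrite invr_gt0.
have : (pairing_sum (seq_scale (C + e)^-1 f) z <= 1)%E.
  apply: le_trans z1; apply: ereal_sup_ubound; exists (seq_scale (C + e)^-1 f) => //.
  split; first exact: EZ.
  rewrite (le_trans (EN _ _ CeV))//.
  rewrite (le_trans (lee_scale_fin CeV fC))// lee_fin.
  by rewrite ler_pdivrMl// mulr1 lerDl ltW.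
by rewrite pairing_sumZl// lee_pdivrMl// mule1.
Qed.

End homogeneity.

(** The norm tests only the ball of [ell_weak], whereas membership concerns all its elements; a
    positive multiple of each of them lies in the ball. *)
Lemma mid_norm_mem (R : realType) (k : scalar_kind) (p : R)
    (Z : normedModType (scalars R k)) (z : nat -> Z) (C : R) : 1 <= p -> 0 <= C ->
  (seq_norm (ell_mid p Z) z <= C%:E)%E -> seq_mem (ell_mid p Z) z.
Proof.
move=> p1 C0 /(mid_norm_leP p1 _ C0) zC f /(weak_scale_ball p1)[t t0 /zC].
rewrite mid_sumZl// -lee_pdivlMl ?powR_gt0// => /le_lt_trans; apply.
by rewrite -EFinM ltry.
Qed.

(** * Transfer of bounds between an operator and its adjoint *)

Section adjoint_duality.
Context {R : realType} {k : scalar_kind}.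
Local Notation K := (scalars R k).
Variables (X Y : normedModType K) (p : R) (p1 : 1 <= p).
Variables (T : {linear X -> Y}) (hT : continuous T).

Local Notation D := (ell_mid_dual p X).
Local Notation Co := (ell_cohen (hoelder_conjugate p%:E) Y).
Local Notation W := (ell_weak p%:E (dual Y)).
Local Notation M := (ell_mid p (dual X)).
Local Notation T' := (adjoint hT).

(** The Cohen space of index [p*] pairs with the weak space of index [p**], and conjugating twice
    gives back [p], also when [p = 1] and [p*] is infinite. *)
Lemma ell_cohen_conjugate : Co = pairing_dual W.
Proof. by rewrite /ell_cohen hoelder_conjugateK. Qed.

Lemma pairing_sum_adjoint (f : nat -> dual Y) (x : nat -> X) :
  pairing_sum (seq_map T' f) x = pairing_sum f (seq_map T x).
Proof. by []. Qed.

Lemma adjoint_ball_bound (C : R) : 0 <= C -> induced_well_defined W M T' ->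
  ball_bound W M T' C -> ball_bound D Co T C.
Proof.
move=> C0 wd T'C x xB; rewrite ell_cohen_conjugate /=.
apply: ge_ereal_sup => _ [f fB <-]; rewrite -pairing_sum_adjoint.
apply: (@pairing_sum_le_norm R k X (seq_map T' f) x M C _ _ C0 _ _ xB).
- by move=> t f'; exact: mid_memZ.
- exact: mid_norm_subhomogeneous.
- by apply: wd; case: fB.
- exact: T'C.
Qed.

Lemma ball_bound_adjoint (C : R) : 0 <= C ->
  ball_bound D Co T C -> ball_bound W M T' C.
Proof.
move=> C0 TC f fB; apply/(mid_norm_leP p1 _ C0) => phi.
move=> /weak_ballP/(weak_norm_leP p1 _ ler01) phi1.
apply/mid_sum_leP => m n; apply: sum_bidual_le => // [g g1|y yB].
  (* Here [bidual] embeds [dual X] into the third dual, against which the weak norm of [phi] is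
     tested. *)
  by have := phi1 (bidual g) (le_trans (rnorm_bidual g) g1) m; rewrite powR1.
rewrite pairing_sum_adjoint; apply: le_trans (TC _ yB).
by rewrite ell_cohen_conjugate; apply: ereal_sup_ubound; exists f.
Qed.

(** A finite mid norm entails membership, and scaling into the ball and back extends this from the
    ball to the whole weak space. *)
Lemma induced_adjoint_well_defined (C : R) : 0 <= C ->
  ball_bound W M T' C -> induced_well_defined W M T'.
Proof.
move=> C0 T'C f /(weak_scale_ball p1)[t t0 /T'C].
move=> /(mid_norm_mem p1 C0) H.
have tV : 0 < t^-1 by rewrite invr_gt0.
have := mid_memZ tV H.
by rewrite seq_map_scale seq_scaleK ?gt_eqF.
Qed.

Lemma induced_well_defined_adjoint :
  induced_well_defined W M T' -> induced_well_defined D Co T.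
Proof.
move=> wd x xD; rewrite ell_cohen_conjugate => f fW.
by rewrite -pairing_sum_adjoint; exact/xD/wd.
Qed.

Lemma induced_norm_leP (U V : normedModType K) (E : seq_space R U)
    (F : seq_space R V) (u : {linear U -> V}) (C : R) :
  (induced_norm E F u <= C%:E)%E <-> ball_bound E F u C.
Proof.
split=> [uC z zE|uC]; first by apply: le_trans uC; apply: ereal_sup_ubound; exists z.
by apply: ge_ereal_sup => _ [z zE <-]; exact: uC.
Qed.

Lemma ell_mid_dual_ball0 : seq_ball D 0.
Proof.
split=> [f _|]; last apply: ge_ereal_sup => _ [f _ <-].
all: by rewrite [pairing_sum _ _]eseries0 ?ltry// => j _ _; rewrite linear0 rnorm0.
Qed.

Lemma induced_norm_ge0 : (0 <= induced_norm D Co T)%E.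
Proof.
apply: le_ereal_sup_tmp; exists (seq_norm Co (seq_map T 0%R)).
  by exists 0 => //; exact: ell_mid_dual_ball0.
rewrite ell_cohen_conjugate; apply: le_ereal_sup_tmp.
exists (pairing_sum 0%R (seq_map T 0%R)); first by exists 0 => //; exact: weak_ball0.
by apply: nneseries_ge0 => j _ _; rewrite lee_fin rnorm_ge0.
Qed.

Lemma weakly_mid_norm_ge0 : (0 <= weakly_mid_norm p T')%E.
Proof.
apply: le_ereal_sup_tmp; exists (seq_norm M (seq_map T' 0%R)).
  by exists 0 => //; exact: weak_ball0.
apply: le_ereal_sup_tmp; exists (mid_sum p 0%R (seq_map T' 0%R) `^ p^-1)%E.
  by exists 0 => //; exact: weak_ball0.
exact: poweR_ge0.
Qed.

End adjoint_duality.

Unset Implicit Arguments.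

Theorem proposition2p7 (R : realType) (k : scalar_kind)
    (X Y : completeNormedModType (scalars R k)) (p : R) (hp : 1 <= p)
    (T : {linear X -> Y}) (hT : continuous T) :
  ((induced_well_defined
      (ell_mid_dual p X) (ell_cohen (hoelder_conjugate p%:E) Y) T /\
    induced_continuous
      (ell_mid_dual p X) (ell_cohen (hoelder_conjugate p%:E) Y) T)
   <-> weakly_mid_summing p (adjoint hT)) /\
  (weakly_mid_summing p (adjoint hT) ->
   weakly_mid_norm p (adjoint hT) =
   induced_norm (ell_mid_dual p X) (ell_cohen (hoelder_conjugate p%:E) Y) T).
Proof.
have homD := @pairing_linear_domain R k X (ell_mid p (dual X)).
have homW := @weak_linear_domain R k p hp (dual Y).
have homM := @mid_norm_subhomogeneous R k p hp (dual X).
have homC : norm_subhomogeneous (ell_cohen (hoelder_conjugate p%:E) Y).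
  exact: pairing_norm_subhomogeneous.
split; first split=> [[wd ct]|[wd ct]].
- have [C C0 TC] := induced_continuous_bounded homD homC ct.
  have T'C := ball_bound_adjoint hp hT C0 TC.
  exact (conj (induced_adjoint_well_defined hp C0 T'C)
    (bounded_induced_continuous homW homM C0 T'C)).
- have [C C0 T'C] := induced_continuous_bounded homW homM ct.
  exact (conj (induced_well_defined_adjoint wd)
    (bounded_induced_continuous homD homC C0 (adjoint_ball_bound hp C0 wd T'C))).
(* A finite upper bound for either norm is a ball bound, and ball bounds transfer in both directions
   without loss; this also settles the case of an infinite value. *)
move=> [wd _]; apply: ge0_eq_le_fin.
- exact: weakly_mid_norm_ge0.
- exact: induced_norm_ge0.
move=> C C0; split=> /induced_norm_leP H; apply/induced_norm_leP.
  exact (adjoint_ball_bound hp C0 wd H).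
exact (ball_bound_adjoint hp hT C0 H).
Qed.
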